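(* Let $\Lambda\in\mathcal{L}$ and $h\in\widetilde{\mathcal{H}}_\Lambda$. Then in $\widetilde{\mathcal{H}}_\Lambda$ \begin{align*} \mathbf{1}^+h&=\sum_{w\in W}t(w_0)\,\Big[w_0\Big(\sum_{\hat w\in W}\pi\big(T_{(w_0w)^{-1}}^{-1}T_{\hat w^{-1}}\big)\gamma_{\hat w}(h)\Big)\Big]T_w,\\ \mathbf{1}^-h&=\sum_{w\in W}t(w_0)^{-1}(-1)^{l(w)}\Big[w_0\,\iota\Big(\sum_{\hat w\in W}(-1)^{l(\hat w)}\pi\big(T_{w_0w}T_{\hat w}^{-1}\big)\iota\gamma_{\hat w}(h)\Big)\Big]T_w, \end{align*} where the bracketed expressions are elements of $\mathbb{F}[\Lambda]$.
   Context: Let $E$ be a Euclidean space with dual $E^*$ and $\Phi\subset E^*$ a reduced irreducible root system (in its span). For $\alpha\in\Phi$, $\alpha^\vee\in E$ is the vector with $\langle y,\alpha^\vee\rangle=2\alpha(y)/\|\alpha\|^2$ for all $y\in E$. Fix simple roots $\alpha_1,\dots,\alpha_r$; $W$ is the finite Weyl group, with simple reflections $s_i$, acting on $E$ by $s_\alpha(y)=y-\alpha(y)\alpha^\vee$; $l$ is the length, $w_0$ the longest element. $Q^\vee$ is the coroot lattice. $\mathcal{L}$ is the set of finitely generated abelian subgroups $\Lambda\subset E$ with $Q^\vee\subseteq\Lambda$ and $\alpha(\Lambda)\subseteq\mathbb{Z}$ for all $\alpha\in\Phi$. $\mathbb{F}$ is a field; $\mathbb{F}[\Lambda]$ is the group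 algebra with basis $x^\lambda$; $W$ acts by $wx^\lambda=x^{w\lambda}$; $\iota$ is the linear map $x^\lambda\mapsto x^{-\lambda}$. Fix a $W$-invariant map $\Phi\to\mathbb{F}^\times$, $\alpha\mapsto t_\alpha$; $t_j=t_{\alpha_j}$, and $t(w)=t_{j_1}\cdots t_{j_k}$ for a reduced expression $w=s_{j_1}\cdots s_{j_k}$. For $f\in\mathbb{F}[\Lambda]$, $\nabla_j(f)=\frac{s_jf-f}{x^{\alpha_j^\vee}-1}$. The extended affine Hecke algebra $\widetilde{\mathcal{H}}_\Lambda$ is generated by $T_1,\dots,T_r$ and $x^\lambda$ ($\lambda\in\Lambda$) with: braid relations; $(T_j-t_j)(T_j+t_j^{-1})=0$; $x^\lambda x^\mu=x^{\lambda+\mu}$, $x^0=1$; $T_jx^\lambda-x^{s_j\lambda}T_j=(t_j-t_j^{-1})\nabla_j(x^\lambda)$. $T_w=T_{j_1}\cdots T_{j_k}$ for a reduced expression. $\widetilde{\mathcal{H}}_\Lambda$ is a free left $\mathbb{F}[\Lambda]$-module with basis $T_w$, $w\in W$; $\gamma_w:\widetilde{\mathcal{H}}_\Lambda\to\mathbb{F}[\Lambda]$ is defined by $h=\sum_{w\in W}\gamma_w(h)T_w$. $\mathbf{1}^+=\sum_{w\in W}t(w)T_w$, $\mathbf{1}^-=\sum_{w\in W}(-1)^{l(w)}t(w)^{-1}T_w$. The polynomial representation $\pi$ of $\widetilde{\mathcal{H}}_\Lambda$ on $\mathbb{F}[\Lambda]$: $\pi(T_j)f=t_js_jf+(t_j-t_j^{-1})\nabla_j(f)$,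 and $\pi(x^\mu)$ is multiplication by $x^\mu$. *)

(* Defs.v *)
From HB Require Import structures.
From mathcomp Require Import all_boot all_order all_algebra.
From mathcomp Require Import finmap.
From mathcomp.multinomials Require Import monalg.
From mathcomp Require Import boolp classical_sets fsbigop reals.

Set Implicit Arguments.
Unset Strict Implicit.
Unset Printing Implicit Defensive.

Import Order.TTheory GRing.Theory Num.Theory.

Local Open Scope ring_scope.

(* The ring structure on {malg F[K]} in multinomials requires a monoid K in
   which only the unit is invertible, which excludes groups; [galg F L] is the
   same module with the multiplication of the group algebra of (L, +). *)
Definition galg (F : fieldType) (L : zmodType) : Type := {malg F[L]}.

HB.instance Definition _ (F : fieldType) (L : zmodType) :=
  GRing.Lmodule.copy (galg F L) {malg F[L]}.

HB.lock Definition gexp (F : fieldType) (L : zmodType) (l : L) : galg F L :=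
  mkmalgU l 1.

(* The linear extension of x^l |-> X l *)
HB.lock Definition glin (F : fieldType) (L : zmodType) (V : lmodType F)
    (X : L -> V) (f : galg F L) : V :=
  \sum_(l <- msupp f) mcoeff l f *: X l.

HB.lock Definition gmul (F : fieldType) (L : zmodType) (f g : galg F L) :
  galg F L := glin (fun k => glin (fun l => gexp F (k + l)) g) f.

Section GroupAlgebra.
Variables (F : fieldType) (L : zmodType).
Implicit Types (f g h : galg F L) (V : lmodType F).
Local Notation gexp := (@gexp F L).
Local Notation gmul := (@gmul F L).

Definition gcoef (l : L) f : F := mcoeff l f.
Definition gsupp f : {fset L} := msupp f.

Lemma gcoefD l f g : gcoef l (f + g) = gcoef l f + gcoef l g.
Proof. exact: mcoeffD. Qed.

Lemma gcoefZ l c f : gcoef l (c *: f) = c * gcoef l f.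
Proof. exact: mcoeffZ. Qed.

Lemma gcoef_exp k l : gcoef k (gexp l) = (l == k)%:R.
Proof. by rewrite gexp.unlock; apply: mcoeffU. Qed.

Lemma galgP f g : (forall l, gcoef l f = gcoef l g) -> f = g.
Proof. by move=> fg; apply/malgP => l; apply: fg. Qed.

Lemma glin_expand V (X : L -> V) (d : {fset L}) f :
  (gsupp f `<=` d)%fset -> glin X f = \sum_(l <- d) gcoef l f *: X l.
Proof.
move=> fd; rewrite glin.unlock; apply: big_fset_incl => // l _ /mcoeff_outdom fl.
by rewrite /gcoef fl scale0r.
Qed.

Lemma glin_is_linear V (X : L -> V) : linear (glin X).
Proof.
move=> c f g; pose d := fsetU (gsupp (c *: f + g)) (fsetU (gsupp f) (gsupp g)).
have [dl dr] : (gsupp f `<=` d /\ gsupp g `<=` d)%fset.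
  by split; apply/fsubsetP => x xf; rewrite !in_fsetU xf !orbT.
rewrite (glin_expand X dl) (glin_expand X dr).
rewrite (@glin_expand _ _ d) ?fsubsetUl// scaler_sumr -big_split /=.
by apply: eq_bigr => l _; rewrite gcoefD gcoefZ scalerDl scalerA.
Qed.

HB.instance Definition _ V (X : L -> V) :=
  GRing.isLinear.Build F (galg F L) V *:%R (glin X) (glin_is_linear X).

Lemma glin_exp V (X : L -> V) l : glin X (gexp l) = X l.
Proof.
have lS : (gsupp (gexp l) `<=` [fset l])%fset by rewrite gexp.unlock; apply: msuppU_le.
by rewrite (glin_expand X lS) big_seq_fset1 gcoef_exp eqxx scale1r.
Qed.

Lemma glin_id f : glin gexp f = f.
Proof.
rewrite glin.unlock [RHS](monalgE (f : {malg F[L]})).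
apply: eq_bigr => l _; apply: galgP => k.
by rewrite gcoefZ gcoef_exp mulr_natr; apply/esym/mcoeffU.
Qed.

Lemma galg_ind (P : galg F L -> Prop) :
  P 0 -> (forall c l f, P f -> P (c *: gexp l + f)) -> forall f, P f.
Proof.
move=> P0 PD f; rewrite -(glin_id f) glin.unlock.
elim: (gsupp f : seq L) => [|l s IH]; first by rewrite big_nil.
by rewrite big_cons; apply: PD.
Qed.

Lemma eq_glin V (u v : {linear galg F L -> V}) :
  (forall l, u (gexp l) = v (gexp l)) -> u =1 v.
Proof.
move=> uv; elim/galg_ind => [|c l f IH]; first by rewrite !linear0.
by rewrite [LHS]linearP [RHS]linearP uv IH.
Qed.

Lemma gmulPl c f g h : gmul (c *: f + g) h = c *: gmul f h + gmul g h.
Proof. by rewrite gmul.unlock glin_is_linear. Qed.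

Lemma gmulPr c f g h : gmul f (c *: g + h) = c *: gmul f g + gmul f h.
Proof.
rewrite gmul.unlock; elim/galg_ind: f => [|d l f IH].
  by rewrite !linear0 addr0.
rewrite !(glin_is_linear _ d (gexp l) f) !glin_exp IH glin_is_linear.
rewrite !scalerDr !scalerA (mulrC c d); exact: addrACA.
Qed.

Lemma gmul_exp k l : gmul (gexp k) (gexp l) = gexp (k + l).
Proof. by rewrite gmul.unlock !glin_exp. Qed.

Lemma gmul0 f : gmul f 0 = 0.
Proof. by have := gmulPr (- 1) f 0 0; rewrite !scaleN1r !addNr. Qed.

Lemma g0mul f : gmul 0 f = 0.
Proof. by have := gmulPl (- 1) 0 0 f; rewrite !scaleN1r !addNr. Qed.

Lemma gmul_expC l g : gmul (gexp l) g = gmul g (gexp l).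
Proof.
elim/galg_ind: g => [|c k g IH]; first by rewrite gmul0 g0mul.
by rewrite gmulPl gmulPr IH !gmul_exp (addrC l k).
Qed.

Lemma gmulC : commutative gmul.
Proof.
move=> f g; elim/galg_ind: f => [|c l f IH]; first by rewrite gmul0 g0mul.
by rewrite gmulPl gmulPr IH gmul_expC.
Qed.

Lemma gmulA : associative gmul.
Proof.
have A1 k l h : gmul (gexp k) (gmul (gexp l) h) = gmul (gexp (k + l)) h.
  elim/galg_ind: h => [|e m h IH]; first by rewrite !gmul0.
  by rewrite !gmulPr IH !gmul_exp addrA.
have A2 k g h : gmul (gexp k) (gmul g h) = gmul (gmul (gexp k) g) h.
  elim/galg_ind: g => [|d l g IH]; first by rewrite !(gmul0, g0mul).
  by rewrite gmulPl !gmulPr gmulPl IH A1 gmul_exp.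
move=> f g h; elim/galg_ind: f => [|c l f IH]; first by rewrite !g0mul.
by rewrite !gmulPl IH A2.
Qed.

Lemma gmul1 : left_id (gexp 0) gmul.
Proof.
move=> f; rewrite gmul.unlock glin_exp -[RHS]glin_id glin.unlock.
by apply: eq_bigr => l _; rewrite add0r.
Qed.

Lemma gmulDl : left_distributive gmul +%R.
Proof. by move=> f g h; have := gmulPl 1 f g h; rewrite !scale1r. Qed.

Lemma gexp0_neq0 : gexp 0 != 0.
Proof.
apply/eqP => /(congr1 (gcoef 0)); rewrite gcoef_exp eqxx.
by rewrite [RHS](mcoeff0 (0 : L)) => /eqP; rewrite oner_eq0.
Qed.

HB.instance Definition _ := GRing.Zmodule_isComNzRing.Build (galg F L)
  gmulA gmulC gmul1 gmulDl gexp0_neq0.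

Lemma gscaleAl c f g : c *: gmul f g = gmul (c *: f) g.
Proof. by have := gmulPl c f 0 g; rewrite addr0 g0mul addr0. Qed.

HB.instance Definition _ := GRing.Lmodule_isLalgebra.Build F (galg F L) gscaleAl.

Definition gmap (phi : L -> L) f : galg F L := glin (fun l => gexp (phi l)) f.

Definition giota f : galg F L := gmap -%R f.

End GroupAlgebra.

Section RootSystem.
Variables (R : realType) (E : vectType R) (dot : {dot E for idfun}).
Notation dual := 'Hom(E, R^o).
Implicit Types (a b : dual) (y v : E) (w : 'End(E)).

(* The vector of E representing the linear form a *)
Definition riesz a : E := xget 0 [set v | forall y, dot y v = a y]%classic.

Definition ddot a b : R := dot (riesz a) (riesz b).

Definition coroot a : E := (2 / ddot a a) *: riesz a.

Definition refl a : 'End(E) := linfun (fun y => y - a y *: coroot a).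

Record root_system (Phi : seq dual) : Prop := RootSystem {
  root_nonempty : exists a, a \in Phi;
  root_neq0 : 0 \notin Phi;
  root_refl : forall a b, a \in Phi -> b \in Phi ->
    b - (2 * ddot b a / ddot a a) *: a \in Phi;
  root_integral : forall a b, a \in Phi -> b \in Phi ->
    2 * ddot b a / ddot a a \is a Num.int;
  root_reduced : forall a (c : R), a \in Phi -> c *: a \in Phi ->
    c = 1 \/ c = - 1;
  root_irreducible : forall P : pred dual,
    (exists2 a, a \in Phi & P a) -> (exists2 b, b \in Phi & ~~ P b) ->
    exists a b, [/\ a \in Phi, b \in Phi, P a, ~~ P b & ddot a b != 0]
}.

Record simple_roots (Phi : seq dual) r (alpha : r.-tuple dual) : Prop :=
  SimpleRoots {
  simple_root : {subset alpha <= Phi};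
  simple_free : free alpha;
  simple_span : forall a, a \in Phi -> exists c : 'I_r -> nat,
    a = \sum_(i < r) tnth alpha i *+ c i \/
    a = - \sum_(i < r) tnth alpha i *+ c i
}.

Definition refl_word (s : seq dual) : 'End(E) :=
  foldr (fun a w => (refl a \o w)%VF) \1%VF s.

Definition weyl (Phi : seq dual) : set 'End(E) :=
  [set w | exists2 s, {subset s <= Phi} & w = refl_word s]%classic.

Definition weyl_dual w a : dual := (a \o w^-1)%VF.

Section Length.
Variables (r : nat) (alpha : r.-tuple dual).

Definition simple_word (s : seq 'I_r) : 'End(E) :=
  refl_word [seq tnth alpha j | j <- s].

Definition reduced_for w (s : seq 'I_r) : Prop :=
  simple_word s = w /\
  forall s', simple_word s' = w -> (size s <= size s')%N.

(* A reduced expression of w, chosen once and for all *)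
Definition redw w : seq 'I_r := xget [::] [set s | reduced_for w s]%classic.

Definition len w : nat := size (redw w).

Definition longest (Phi : seq dual) : 'End(E) :=
  xget \1%VF [set w | weyl Phi w /\
                      forall u, weyl Phi u -> (len u <= len w)%N]%classic.

(* m is the order of s_i s_j *)
Definition refl_order (i j : 'I_r) (m : nat) : Prop :=
  let sij k := simple_word (flatten (nseq k [:: i; j])) in
  [/\ (0 < m)%N, sij m = \1%VF & forall k, (0 < k < m)%N -> sij k <> \1%VF].

End Length.

Record root_lattice (Phi : seq dual) (L : zmodClosed E) : Prop := RootLattice {
  lattice_fg : exists m (b : m.-tuple E), forall v, v \in L <-> inIntSpan b v;
  lattice_coroot : forall v,
    inIntSpan (map_tuple coroot (in_tuple Phi)) v -> v \in L;
  lattice_integral : forall a v, a \in Phi -> v \in L ->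
    (a v : R) \is a Num.int
}.

End RootSystem.

Record latt (R : realType) (E : vectType R) (L : zmodClosed E) := Latt {
  latt_val : E;
  lattP : latt_val \in L
}.

HB.instance Definition _ (R : realType) (E : vectType R) (L : zmodClosed E) :=
  [isSub for @latt_val R E L].
HB.instance Definition _ (R : realType) (E : vectType R) (L : zmodClosed E) :=
  [Choice of latt L by <:].
HB.instance Definition _ (R : realType) (E : vectType R) (L : zmodClosed E) :=
  [SubChoice_isSubZmodule of latt L by <:].

Section Hecke.
Variables (R : realType) (E : vectType R) (dot : {dot E for idfun}).
Notation dual := 'Hom(E, R^o).
Variables (Phi : seq dual) (r : nat) (alpha : r.-tuple dual).
Variables (F : fieldType) (t : dual -> F) (L : zmodClosed E).
Notation A := (galg F (latt L)).

Definition weyl_invariant : Prop :=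
  forall a, a \in Phi ->
    t a != 0 /\ forall w, weyl dot Phi w -> t (weyl_dual w a) = t a.

Definition tj (j : 'I_r) : F := t (tnth alpha j).

Definition tw (w : 'End(E)) : F := \prod_(j <- redw dot alpha w) tj j.

(* Elements of a [root_lattice] are stable under W and include the coroots, so
   the default value 0 of [insubd] is not reached below. *)
Definition lact (w : 'End(E)) (l : latt L) : latt L := insubd 0 (w (val l)).

Definition lcoroot (j : 'I_r) : latt L := insubd 0 (coroot dot (tnth alpha j)).

Definition gact (w : 'End(E)) (f : A) : A := gmap (lact w) f.

Definition lrefl (j : 'I_r) : 'End(E) := refl dot (tnth alpha j).

(* The quotient of s_j f - f by x^{alpha_j^\vee} - 1, which is exact and unique
   since the group algebra of a lattice is an integral domain *)
Definition nabla (j : 'I_r) (f : A) : A :=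
  xget 0 [set g | g * (gexp F (lcoroot j) - 1) = gact (lrefl j) f - f]%classic.

Fixpoint alternating (H : pzRingType) (T : 'I_r -> H) (i j : 'I_r) (m : nat) : H :=
  if m is m'.+1 then T i * alternating T j i m' else 1.

Record hecke_relations (H : algType F) (T : 'I_r -> H) (X : latt L -> H) : Prop :=
  HeckeRelations {
  hecke_braid : forall i j m, refl_order dot alpha i j m ->
    alternating T i j m = alternating T j i m;
  hecke_quadratic : forall j,
    (T j - (tj j)%:A) * (T j + ((tj j)^-1)%:A) = 0;
  hecke_xD : forall k l, X k * X l = X (k + l);
  hecke_x0 : X 0 = 1;
  hecke_cross : forall j l,
    T j * X l - X (lact (lrefl j) l) * T j =
      (tj j - (tj j)^-1) *: glin X (nabla j (gexp F l))
}.

(* H is the F-algebra presented by the generators T_j, x^l and the relations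
   above, i.e. it is initial among the algebras satisfying them. *)
Record affine_hecke (H : algType F) (T : 'I_r -> H) (X : latt L -> H) : Prop :=
  AffineHecke {
  hecke_rel : hecke_relations T X;
  hecke_ex : forall (B : algType F) (T' : 'I_r -> B) (X' : latt L -> B),
    hecke_relations T' X' ->
    exists phi : {lrmorphism H -> B},
      (forall j, phi (T j) = T' j) /\ (forall l, phi (X l) = X' l);
  hecke_uniq : forall (B : algType F) (phi psi : {lrmorphism H -> B}),
    (forall j, phi (T j) = psi (T j)) -> (forall l, phi (X l) = psi (X l)) ->
    phi =1 psi
}.

Definition Tw (H : pzRingType) (T : 'I_r -> H) (w : 'End(E)) : H :=
  \prod_(j <- redw dot alpha w) T j.

Definition one_plus (H : algType F) (T : 'I_r -> H) : H :=
  \sum_(w \in weyl dot Phi) tw w *: Tw T w.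

Definition one_minus (H : algType F) (T : 'I_r -> H) : H :=
  \sum_(w \in weyl dot Phi)
    ((-1) ^+ len dot alpha w * (tw w)^-1) *: Tw T w.

Definition hecke_coordinates (H : algType F) (T : 'I_r -> H)
    (X : latt L -> H) (gamma : 'End(E) -> H -> A) : Prop :=
  forall h, h = \sum_(w \in weyl dot Phi) glin X (gamma w h) * Tw T w.

Record polynomial_rep (H : algType F) (T : 'I_r -> H) (X : latt L -> H)
    (pi : H -> A -> A) : Prop := PolynomialRep {
  rep_linear : forall h, linear (pi h);
  rep_linearl : forall f, linear (pi^~ f);
  rep1 : forall f, pi 1 f = f;
  repM : forall g h f, pi (g * h) f = pi g (pi h f);
  rep_T : forall j f,
    pi (T j) f = tj j *: gact (lrefl j) f + (tj j - (tj j)^-1) *: nabla j f;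
  rep_x : forall l f, pi (X l) f = gexp F l * f
}.

End Hecke.

(* Main.v *)
Require Import Defs.
From HB Require Import structures.
From mathcomp Require Import all_boot all_order all_algebra.
From mathcomp Require Import finmap.
From mathcomp.multinomials Require monalg.
From mathcomp Require Import zify ring.
From mathcomp Require Import boolp classical_sets fsbigop cardinality reals.

Set Implicit Arguments.
Unset Strict Implicit.
Unset Printing Implicit Defensive.

Import Order.TTheory GRing.Theory Num.Theory.

Local Open Scope ring_scope.

(* Pushing T_j through the polynomials gives 1^+ f T_j = 1^+ pi(T_j) f for f in
   F[Lambda], hence 1^+ f T_v = 1^+ pi(T_{v^-1}) f, and it remains to expand
   1^+ f in the basis T_w. Comparing the coefficients c_w of T_w in
   1^+ f T_j = 1^+ pi(T_j) f when l(w s_j) > l(w) yields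
   c_w(pi(T_j) f) = c_{w s_j}(f), which reduces c_w to c_{w_0}; and
   c_{w_0}(f) = t(w_0) w_0(f) because T_w f = w(f) T_w + lower terms. The case of
   1^- is the same with pi(T_j) replaced by -iota pi(T_j)^-1 iota.
   The comparison of coefficients needs the T_w to be linearly independent over
   F[Lambda]: the operators pi(T_w) are triangular, with regular leading
   coefficients, in the Weyl group elements acting on F[Lambda], and these are
   independent by Dedekind's argument. That T_w does not depend on the reduced
   word is Matsumoto's theorem, which follows from the exchange condition. *)

(** Each symmetrizer absorbs T_j on its right as a scalar e_j, and the two scalars t_j and -t_j^-1
    are the roots of the quadratic relation. The cross relation then turns T_j, standing to the
    right of f, into the operator e_j s_j + (t_j - t_j^-1) nabla_j on f; this is where both
    operators of the statement come from, and why one argument with abstract operators and right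
    inverses serves both signs. The obstacle is uniqueness: [hecke_coordinates] provides an
    expansion in the T_w, but comparing coefficients needs the expansion to be unique, and only the
    polynomial representation can detect that. There [nabla] divides by x^{alpha_j^vee} - 1. Instead
    of passing to fractions, each operator is multiplied by a denominator, and all that is asked of
    denominators and leading coefficients is regularity. Regularity survives products and the action
    of W, so it has to be checked only on binomials. *)

Lemma linfun_apply (R : nzRingType) (aT rT : vectType R) (f : aT -> rT) :
  linear f -> linfun f =1 f.
Proof.
move=> fl; pose ff : {linear aT -> rT} := HB.pack f (GRing.isLinear.Build R aT rT _ f fl).
exact: (lfunE ff).
Qed.

(** * Reflections in a Euclidean space *)

Section Euclidean.
Variables (R : realType) (E : vectType R) (dot : {dot E for idfun}).
Notation dual := 'Hom(E, R^o).
Implicit Types (a b : dual) (y v : E) (u w : 'End(E)).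

Lemma dotC y v : dot y v = dot v y.
Proof. by rewrite hermC expr0 mul1r. Qed.

Lemma dot_eq0 v : (dot v v == 0) = (v == 0).
Proof.
have [->|v0] := eqVneq v 0; first by rewrite linear0 eqxx.
by apply/negbTE; rewrite gt_eqF// neq0_dnorm_gt0.
Qed.

Lemma dot_eq v v' : (forall y, dot y v = dot y v') -> v = v'.
Proof.
move=> vv'; apply/eqP; rewrite -subr_eq0 -dot_eq0.
by rewrite linearBr /= vv' subrr.
Qed.

(** Nondegeneracy makes the map from v to its products with a basis injective, hence surjective by
    dimension. *)
Lemma riesz_ex a : exists v, forall y, dot y v = a y.
Proof.
set n := \dim {:E}; pose e i := (vbasis {:E})`_i.
have fl : linear (fun v => \row_(i < n) dot (e i) v : 'rV[R]_n).
  by move=> c v v'; apply/rowP => i; rewrite !mxE linearPr.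
set f := linfun (fun v => \row_(i < n) dot (e i) v : 'rV[R]_n).
have fE v : f v = \row_(i < n) dot (e i) v by exact: linfun_apply.
have e_dot (b : dual) v : (forall i : 'I_n, dot (e i) v = b (e i)) -> forall y, dot y v = b y.
  move=> eb y; rewrite (coord_vbasis (memvf y)) dotC !linear_sum /=.
  by apply: eq_bigr => i _; rewrite linearZr_LR linearZ /= dotC eb.
have f0 : lker f == 0%VS.
  apply/lker0P => v v' /rowP fvv'; apply: dot_eq => y.
  have dl : linear (fun y => dot y v' : R^o) by move=> c x x'; rewrite linearPl.
  rewrite (e_dot (linfun (fun y => dot y v' : R^o)) v) ?linfun_apply//.
  by move=> i; have := fvv' i; rewrite !fE !mxE linfun_apply.
have : \row_(i < n) (a (e i) : R) \in limg f.
  suff -> : limg f = fullv by exact: memvf.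
  apply/eqP; rewrite eqEdim subvf /= limg_dim_eq ?(eqP f0) ?capv0//.
  by rewrite dimvf dim_matrix mul1r.
move=> /memv_imgP[v _ /rowP av]; exists v; apply: e_dot => i.
by have := av i; rewrite fE !mxE.
Qed.

Lemma rieszE a y : dot y (riesz dot a) = a y.
Proof.
rewrite /riesz; case: xgetP => [v _ vP|vP]; first exact: vP.
by have [v va] := riesz_ex a; case: (vP v).
Qed.

Lemma riesz_unique a v : (forall y, dot y v = a y) -> riesz dot a = v.
Proof. by move=> va; apply: dot_eq => y; rewrite rieszE va. Qed.

Lemma rieszZ c a : riesz dot (c *: a) = c *: riesz dot a.
Proof.
by apply: riesz_unique => y; rewrite linearZr_LR /= rieszE scale_lfunE.
Qed.

Lemma riesz_eq0 a : (riesz dot a == 0) = (a == 0).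
Proof.
apply/eqP/eqP => [a0|->]; last first.
  by apply: riesz_unique => y; rewrite linear0r zero_lfunE.
by apply/lfunP => y; rewrite -rieszE a0 linear0r zero_lfunE.
Qed.

Lemma ddotE a b : ddot dot a b = b (riesz dot a).
Proof. by rewrite /ddot rieszE. Qed.

Lemma ddotC a b : ddot dot a b = ddot dot b a.
Proof. exact: dotC. Qed.

Lemma ddot_gt0 a : a != 0 -> 0 < ddot dot a a.
Proof. by move=> a0; rewrite neq0_dnorm_gt0// riesz_eq0. Qed.

Lemma app_coroot a b : b (coroot dot a) = 2 * ddot dot b a / ddot dot a a.
Proof. by rewrite linearZ /= -ddotE ddotC /GRing.scale /= mulrAC. Qed.

Lemma coroot_self a : a != 0 -> a (coroot dot a) = 2.
Proof. by move=> a0; rewrite app_coroot mulfK// gt_eqF// ddot_gt0. Qed.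

Lemma dot_coroot a y : a != 0 ->
  dot y (coroot dot a) * ddot dot a a = 2 * a y.
Proof.
move=> a0; rewrite linearZr_LR /= rieszE mulrAC divfK//.
by rewrite gt_eqF// ddot_gt0.
Qed.

Lemma rieszN a : riesz dot (- a) = - riesz dot a.
Proof. by rewrite -scaleN1r rieszZ scaleN1r. Qed.

Lemma corootN a : coroot dot (- a) = - coroot dot a.
Proof. by rewrite /coroot /ddot rieszN linearNl linearNr /= opprK scalerN. Qed.

Lemma reflE a y : refl dot a y = y - a y *: coroot dot a.
Proof.
apply: linfun_apply; move: (coroot dot a) => k c v v'.
by rewrite linearP scalerDl opprD scalerBr scalerA addrACA.
Qed.

Lemma reflN a : refl dot (- a) = refl dot a.
Proof. by apply/lfunP => y; rewrite !reflE corootN opp_lfunE scaleNr scalerN opprK. Qed.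

Lemma app_refl_self a y : a != 0 -> a (refl dot a y) = - a y.
Proof.
move=> a0; rewrite reflE linearB [X in _ - X]linearZ /= coroot_self//.
by rewrite /GRing.scale /=; ring.
Qed.

Lemma reflK a : a != 0 -> (refl dot a \o refl dot a)%VF = \1%VF.
Proof.
move=> a0; apply/lfunP => y; rewrite comp_lfunE id_lfunE [LHS]reflE.
by rewrite app_refl_self// scaleNr opprK reflE subrK.
Qed.

Lemma comp_reflE a b :
  (b \o refl dot a)%VF = b - (2 * ddot dot b a / ddot dot a a) *: a.
Proof.
apply/lfunP => y; rewrite comp_lfunE reflE linearB linearZ /= app_coroot.
by rewrite add_lfunE opp_lfunE scale_lfunE /GRing.scale /= mulrC.
Qed.

Lemma comp_refl_self a : a != 0 -> (a \o refl dot a)%VF = - a.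
Proof.
move=> a0; rewrite comp_reflE mulfK ?gt_eqF ?ddot_gt0//.
by rewrite scaler_nat mulr2n opprD addNKr.
Qed.

Definition orthogonal_map u := forall y v, dot (u y) (u v) = dot y v.

Lemma dot_subZ k y v (c d : R) : dot (y - c *: k) (v - d *: k) =
  dot y v - d * dot y k - c * dot v k + c * d * dot k k.
Proof.
rewrite linearBl /= !linearBr /= !linearZl_LR !linearZr_LR /= (dotC k v).
by ring.
Qed.

Lemma refl_orthogonal a : a != 0 -> orthogonal_map (refl dot a).
Proof.
move=> a0 y v; rewrite !reflE dot_subZ.
have := dot_coroot y a0; have := dot_coroot v a0.
have := dot_coroot (coroot dot a) a0; rewrite coroot_self//.
move: (dot _ (coroot dot a)) (dot v _) (dot y (coroot dot a)) => p q s.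
have := ddot_gt0 a0; move: (ddot dot a a) => n /lt0r_neq0 n0 hp hq hs.
have -> : q = 2 * a v / n by rewrite -hq mulfK.
have -> : s = 2 * a y / n by rewrite -hs mulfK.
have -> : p = 4 / n by apply: (mulIf n0); rewrite hp divfK//; ring.
by field.
Qed.

(** An orthogonal [u] carries the vector of [a \o u] to that of [a], hence coroot to coroot. The
    right inverse [u'] serves to write every vector as a value of [u]. *)
Lemma orthogonal_refl u u' a b : (u \o u')%VF = \1%VF -> orthogonal_map u ->
  (a \o u)%VF = b -> (u \o refl dot b)%VF = (refl dot a \o u)%VF.
Proof.
move=> uK ou ab.
have ur : u (riesz dot b) = riesz dot a.
  apply/esym/riesz_unique => y; rewrite -[y](id_lfunE y) -uK comp_lfunE ou.
  by rewrite rieszE -ab comp_lfunE.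
have uc : u (coroot dot b) = coroot dot a.
  by rewrite /coroot [LHS]linearZ /= ur /ddot -(ou (riesz dot b)) ur.
apply/lfunP => y; rewrite !comp_lfunE !reflE [LHS]linearB /= [X in _ - X]linearZ.
by rewrite /= uc -ab comp_lfunE.
Qed.

End Euclidean.

(** * Group algebras *)

Section GroupAlgebra.
Variables (F : fieldType) (L : zmodType).
Implicit Types (f g h : galg F L) (a b k l : L) (phi psi : L -> L).

Lemma gexpD k l : gexp F (k + l) = gexp F k * gexp F l.
Proof. by rewrite -gmul_exp. Qed.

Lemma gexp0 : gexp F (0 : L) = 1.
Proof. by []. Qed.

Lemma gmulZr c f g : f * (c *: g) = c *: (f * g).
Proof. by rewrite mulrC -scalerAl mulrC. Qed.

Lemma gcoef0 l : gcoef l (0 : galg F L) = 0.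
Proof. by rewrite -(scale0r (0 : galg F L)) gcoefZ mul0r. Qed.

Lemma gcoef_expM a l g : gcoef l (gexp F a * g) = gcoef (l - a) g.
Proof.
elim/galg_ind: g => [|c k g IH]; first by rewrite mulr0 !gcoef0.
rewrite mulrDr !gcoefD IH gmulZr -gexpD !gcoefZ !gcoef_exp.
by congr (_ * _%:R + _); rewrite -(inj_eq (addrI (- a))) addKr addrC.
Qed.

Lemma gcoef_neq0 f : f != 0 -> exists l, gcoef l f != 0.
Proof.
move=> /eqP f0; apply: contrapT => no; apply: f0; apply: galgP => l.
by rewrite gcoef0; apply: contrapT => /eqP fl; apply: no; exists l.
Qed.

Lemma mem_gsupp f l : gcoef l f != 0 -> l \in gsupp f.
Proof. by apply: contraNT => /monalg.mcoeff_outdom fl; apply/eqP. Qed.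

Lemma gmap_is_linear phi : linear (gmap phi : galg F L -> galg F L).
Proof. by move=> c f g; rewrite /gmap linearP. Qed.

HB.instance Definition _ phi :=
  GRing.isLinear.Build F (galg F L) (galg F L) *:%R (gmap phi) (gmap_is_linear phi).

Lemma gmap_exp phi l : gmap phi (gexp F l) = gexp F (phi l).
Proof. exact: glin_exp. Qed.

Lemma gmap_comp phi psi f : gmap phi (gmap psi f) = gmap (phi \o psi) f.
Proof.
elim/galg_ind: f => [|c l f IH]; first by rewrite !linear0.
by rewrite [gmap psi _]linearP [LHS]linearP [RHS]linearP /= !gmap_exp IH.
Qed.

Lemma eq_gmap phi psi f : phi =1 psi -> gmap phi f = gmap psi f.
Proof. by move=> e; rewrite /gmap; congr glin; apply/funext => l; rewrite e. Qed.

Lemma gmap_id f : gmap id f = f.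
Proof. exact: glin_id. Qed.

Lemma gmapM phi f g : {morph phi : k l / k + l} ->
  gmap phi (f * g) = gmap phi f * gmap phi g.
Proof.
move=> phiD; elim/galg_ind: f => [|c k f IH]; first by rewrite mul0r linear0 mul0r.
rewrite mulrDl [LHS]linearD /= IH [gmap phi (_ + f)]linearP mulrDl /= gmap_exp.
congr (_ + _); rewrite -!scalerAl linearZ /=; congr (_ *: _).
elim/galg_ind: g {IH} => [|d l g IHg]; first by rewrite mulr0 !linear0 mulr0.
rewrite mulrDr gmulZr -gexpD [LHS]linearP [gmap phi (_ + g)]linearP /= IHg !gmap_exp.
by rewrite phiD gexpD mulrDr gmulZr.
Qed.

Hypothesis torsion_free : forall l n, l *+ n.+1 = 0 -> l = 0.

(* An element of the annihilator has a support stable under translation by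
   [a - b], hence empty. *)
Lemma lreg_gexp2 (c d : F) a b : c != 0 -> d != 0 -> a != b ->
  GRing.lreg (c *: gexp F a + d *: gexp F b).
Proof.
move=> c0 d0 ab; apply: mulrI0_lreg => g e; apply: contrapT => /eqP g0.
have [l gl] := gcoef_neq0 g0.
have gcoefN k : gcoef k g != 0 -> gcoef (k + (a - b)) g != 0.
  move=> gk; have := congr1 (gcoef (k + a)) e.
  rewrite mulrDl -!scalerAl gcoefD !gcoefZ !gcoef_expM gcoef0 addrK -addrA.
  by apply: contra_eqN => /eqP ->; rewrite mulr0 addr0 mulf_neq0.
have gn n : gcoef (l + (a - b) *+ n) g != 0.
  by elim: n => [|n IH]; rewrite ?mulr0n ?addr0// mulrS (addrC (a - b)) addrA gcoefN.
have inj : injective (fun n => l + (a - b) *+ n).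
  have lt m n : (m < n)%N -> l + (a - b) *+ m <> l + (a - b) *+ n.
    move=> mn /addrI; rewrite -(subnKC mn) addSnnS mulrnDr -[LHS]addr0 => /addrI/esym.
    by move/torsion_free/eqP; rewrite subr_eq0 (negbTE ab).
  move=> m n e'; case: (ltngtP m n) => // /lt; first by move/(_ e').
  by move/(_ (esym e')).
pose s := map (fun n => l + (a - b) *+ n) (iota 0 (size (gsupp g : seq L)).+1).
have : (size s <= size (gsupp g : seq L))%N.
  apply: uniq_leq_size; first by rewrite map_inj_uniq ?iota_uniq.
  by move=> k /mapP[n _ ->]; apply: mem_gsupp.
by rewrite size_map size_iota ltnn.
Qed.

End GroupAlgebra.

(** * Identities for clearing denominators *)

Section CommutativeAlgebra.
Variables (F : fieldType) (B : lalgType F).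
Hypothesis mulC : commutative (@GRing.mul B).
Implicit Types (x y n h d e p q : B) (a b : F).

(** For x = x^{alpha_j^vee}, h = f, y = s_j f, n = nabla_j f, a = t_j and b = t_j^-1, the second
    factor on the left is pi(T_j) f. *)
Lemma demazure_lusztig_clear a b x y n h : n * (x - 1) = y - h ->
  (x - 1) * (a *: y + (a - b) *: n) = (a *: x - b%:A) * y - (a - b) *: h.
Proof.
move=> nE; rewrite mulC mulrDl -2!scalerAl nE scalerBr addrA.
rewrite mulrBr mulr1 mulrBl -2!scalerAl mul1r (mulC x).
by rewrite scalerBr scalerBl !addrA addrNK.
Qed.

(** Here [d] is a denominator already known for h, and [e], its image under s_j, is one for y = s_j
    h; multiplying by both clears the two terms at once. *)
Lemma clear_denominators c x d e p q y h : x * p = q * y - c *: h ->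
  x * e * d * p = q * d * (e * y) - c *: (e * (d * h)).
Proof.
have mulCA (u v w : B) : u * (v * w) = v * (u * w) by rewrite !mulrA (mulC u).
move=> xp; rewrite -!mulrA (mulCA x e) (mulCA x d) xp !mulrBr.
rewrite (mulC d (c *: h)) -scalerAl (mulC e (c *: _)) -scalerAl (mulC h) (mulC _ e).
by rewrite (mulCA d e y) (mulCA q e) (mulCA q d).
Qed.

Lemma sum_subZ_mull (I : Type) (s : seq I) (k l : B) a (f g u : I -> B) :
  k * (\sum_(i <- s) f i * u i) - a *: (l * \sum_(i <- s) g i * u i) =
  \sum_(i <- s) (k * f i - a *: (l * g i)) * u i.
Proof.
rewrite !mulr_sumr scaler_sumr -sumrB; apply: eq_bigr => i _.
by rewrite mulrBl -scalerAl !mulrA.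
Qed.
End CommutativeAlgebra.

(** With y = s_j f and n = nabla_j f, the left side is -iota pi(T_j)^-1 iota f after [giota_nabla],
    and the right side is the operator belonging to the eigenvalue -t_j^-1. *)
Lemma opp_scale_sub (F : fieldType) (V : lmodType F) (a b : F) (f y n : V) :
  - (a *: y + (a - b) *: (f - y - n) - (a - b) *: f) = - b *: y + (a - b) *: n.
Proof.
have -> : (a - b) *: (f - y - n) = (a - b) *: f - ((a - b) *: y + (a - b) *: n).
  by rewrite !scalerBr opprD addrA.
rewrite -addrA [_ - _ - (a - b) *: f]addrAC subrr sub0r opprB addrAC.
by rewrite [(a - b) *: y]scalerBl [_ - _ - a *: y]addrAC subrr sub0r scaleNr.
Qed.

(** * Weyl groups *)

Lemma finite_set_inj (T : choiceType) (U : finType) (f : T -> U) (A : set T) :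
  (forall x y, A x -> A y -> f x = f y -> x = y) -> finite_set A.
Proof.
move=> finj; have [[x0 _]|A0] := pselect (exists x, A x); last first.
  by rewrite (_ : A = set0)// predeqE => x; split=> // Ax; case: A0; exists x.
pose g y := xget x0 [set x | A x /\ f x = y]%classic.
apply: (sub_finite_set (B := [set g y | y in [set: U]]%classic)); last first.
  by apply: finite_image; apply: finite_finset.
move=> x Ax; exists (f x) => //; rewrite /g; case: xgetP => [y _ [Ay fy]|/(_ x)].
  exact: finj.
by case.
Qed.

Lemma finite_set_bounded (T : choiceType) n m (f : T -> 'I_n -> nat) (A : set T) :
  (forall x i, A x -> (f x i <= m)%N) ->
  (forall x y, A x -> A y -> (forall i, f x i = f y i) -> x = y) -> finite_set A.
Proof.
move=> fm finj; apply: (@finite_set_inj _ _ (fun x => [ffun i => inord (f x i) : 'I_m.+1])).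
move=> x y Ax Ay /ffunP e; apply: finj => // i.
by have := congr1 val (e i); rewrite !ffunE /= !inordK ?ltnS ?fm.
Qed.

Section Weyl.
Variables (R : realType) (E : vectType R) (dot : {dot E for idfun}).
Notation dual := 'Hom(E, R^o).
Variables (Phi : seq dual) (r : nat) (alpha : r.-tuple dual).
Hypothesis rootPhi : root_system dot Phi.
Hypothesis simple_alpha : simple_roots Phi alpha.
Implicit Types (a b : dual) (i j : 'I_r) (s : seq 'I_r) (u w : 'End(E)).

Local Notation al := (tnth alpha).
Local Notation sr j := (refl dot (al j)).
Local Notation sw := (simple_word dot alpha).

Lemma neq0_root a : a \in Phi -> a != 0.
Proof. by apply: contraTneq => ->; apply: root_neq0 rootPhi. Qed.

Lemma mem_simple j : al j \in Phi.
Proof. by apply: (simple_root simple_alpha); apply: mem_tnth. Qed.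

Lemma neq0_simple j : al j != 0.
Proof. exact: neq0_root (mem_simple j). Qed.

Lemma comp_refl_root a b : a \in Phi -> b \in Phi -> (b \o refl dot a)%VF \in Phi.
Proof. by move=> aP bP; rewrite comp_reflE; apply: root_refl. Qed.

Lemma rootN a : a \in Phi -> - a \in Phi.
Proof.
by move=> aP; rewrite -(comp_refl_self dot (neq0_root aP)); apply: comp_refl_root.
Qed.

Lemma sw_cons j s : sw (j :: s) = (sr j \o sw s)%VF.
Proof. by []. Qed.

Lemma sw_cat s s' : sw (s ++ s') = (sw s \o sw s')%VF.
Proof. by elim: s => [|j s IH]; rewrite ?comp_lfun1l// !sw_cons IH comp_lfunA. Qed.

Lemma sw_rcons s j : sw (rcons s j) = (sw s \o sr j)%VF.
Proof. by rewrite -cats1 sw_cat sw_cons comp_lfun1r. Qed.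

Lemma srK j : (sr j \o sr j)%VF = \1%VF.
Proof. exact: reflK (neq0_simple j). Qed.

Lemma sw_revK s : (sw s \o sw (rev s))%VF = \1%VF.
Proof.
elim: s => [|j s IH]; first by rewrite comp_lfun1l.
by rewrite rev_cons sw_rcons sw_cons -comp_lfunA (comp_lfunA (sw s)) IH
  comp_lfun1l srK.
Qed.

Lemma sw_Krev s : (sw (rev s) \o sw s)%VF = \1%VF.
Proof. by rewrite -{2}(revK s) sw_revK. Qed.

Lemma sw_inj s u w : (sw s \o u)%VF = (sw s \o w)%VF -> u = w.
Proof.
by move=> e; rewrite -[u]comp_lfun1l -[w]comp_lfun1l -(sw_Krev s) -!comp_lfunA e.
Qed.

Lemma sw_injr s u w : (u \o sw s)%VF = (w \o sw s)%VF -> u = w.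
Proof.
by move=> e; rewrite -[u]comp_lfun1r -[w]comp_lfun1r -(sw_revK s) !comp_lfunA e.
Qed.

(** The inverse of an endomorphism is total, a pseudo-inverse in general, so it is identified
    through the triviality of the kernel. *)
Lemma sw_inv s : (sw s)^-1%VF = sw (rev s).
Proof.
have k0 : lker (sw s) == 0%VS.
  by apply/lker0P; apply: (can_inj (g := sw (rev s))) => y; rewrite -comp_lfunE sw_Krev id_lfunE.
by apply: (@sw_inj s); rewrite lker0_compfV// sw_revK.
Qed.

Lemma sw_orthogonal s : orthogonal_map dot (sw s).
Proof.
elim: s => [|j s IH] y v; first by rewrite !id_lfunE.
by rewrite sw_cons !comp_lfunE refl_orthogonal ?neq0_simple.
Qed.

Lemma comp_sw_root b s : b \in Phi -> (b \o sw s)%VF \in Phi.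
Proof.
elim: s b => [|j s IH] b bP; first by rewrite comp_lfun1r.
by rewrite sw_cons comp_lfunA; apply: IH; apply: comp_refl_root; rewrite ?mem_simple.
Qed.

(** * Positive roots and the exchange condition *)

Definition pos a := [forall i, 0 <= coord alpha i a].

Lemma coord_simple i j : coord alpha i (al j) = (i == j)%:R.
Proof. by rewrite (tnth_nth 0) coord_free ?(simple_free simple_alpha)// eq_sym. Qed.

Lemma coord_root a i : a \in Phi -> exists n : nat,
  coord alpha i a = (if pos a then 1 else -1) * n%:R.
Proof.
move=> aP; have [c ac] := simple_span simple_alpha aP.
have cE k : coord alpha k (\sum_(i < r) al i *+ c i) = (c k)%:R.
  rewrite linear_sum (bigD1 k)//= linearMn /= coord_simple eqxx big1 ?addr0//.
  by move=> l lk; rewrite linearMn /= coord_simple eq_sym (negbTE lk) mul0rn.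
exists (c i); case: ac => ac.
  have -> : pos a by apply/forallP => k; rewrite ac cE ler0n.
  by rewrite ac cE mul1r.
have ncE k : coord alpha k a = - (c k)%:R by rewrite ac linearN /= cE.
(* A nonpositive combination can count as [pos] only if all its coefficients vanish, and then both
   signs give the same value. *)
case: ifP => [|_]; last by rewrite ncE mulN1r.
move=> /forallP/(_ i); rewrite ncE oppr_ge0 lern0 => /eqP ->.
by rewrite oppr0 mulr0.
Qed.

Lemma root_coords a : a \in Phi -> a = \sum_(i < r) coord alpha i a *: al i.
Proof.
move=> aP; rewrite [LHS](@coord_span _ _ _ alpha).
  by apply: eq_bigr => i _; rewrite (tnth_nth 0).
have [c [->|->]] := simple_span simple_alpha aP; rewrite ?rpredN;
  by apply: rpred_sum => i _; rewrite rpredMn// memv_span// mem_tnth.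
Qed.

Lemma root_coord_neq0 a : a \in Phi -> exists i, coord alpha i a != 0.
Proof.
move=> aP; apply: contrapT => a0; have := neq0_root aP.
rewrite (root_coords aP) big1 ?eqxx// => i _.
by have [->|ai] := eqVneq (coord alpha i a) 0; [rewrite scale0r | case: a0; exists i].
Qed.

Lemma posN a : a \in Phi -> pos (- a) = ~~ pos a.
Proof.
move=> aP; case: (boolP (pos a)) => [pa|na]; last first.
  apply/forallP => i; rewrite linearN /= oppr_ge0.
  by have [n ->] := coord_root i aP; rewrite (negbTE na) mulN1r oppr_le0 ler0n.
apply/negP => /forallP pNa; have [i] := root_coord_neq0 aP.
by rewrite eq_le (forallP pa i) -oppr_ge0 -[- _](linearN (coord alpha i)) pNa.
Qed.

Lemma pos_simple j : pos (al j).
Proof. by apply/forallP => i; rewrite coord_simple ler0n. Qed.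

Lemma posP a i : a \in Phi -> 0 < coord alpha i a -> pos a.
Proof.
move=> aP; apply: contraLR => /[dup] na; rewrite -posN// => /forallP/(_ i).
by rewrite linearN /= oppr_ge0 -leNgt.
Qed.

(* A positive root other than [al j] has a positive coordinate off [j], which
   the reflection [sr j] leaves unchanged. *)
Lemma pos_comp_sr a j : a \in Phi -> pos a -> a != al j -> pos (a \o sr j)%VF.
Proof.
move=> aP pa aj; have sP := comp_refl_root (mem_simple j) aP.
(* Otherwise [a] is a multiple of [al j]; as the system is reduced, it is [al j], which is excluded,
   or [- al j], which is not positive. *)
have [i ij ai] : exists2 i, i != j & coord alpha i a != 0.
  apply: contrapT => noi; have := root_coords aP.
  rewrite (bigD1 j)//= big1 ?addr0 => [aE|i ij]; last first.
    by have [->|ai] := eqVneq (coord alpha i a) 0; [rewrite scale0r | case: noi; exists i].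
  have := aP; rewrite {1}aE => /(root_reduced rootPhi (mem_simple j)).
  case=> c; first by move: aj; rewrite aE c scale1r eqxx.
  by move/forallP: pa => /(_ j); rewrite c ler0N1.
apply: (posP (i := i)) => //; rewrite comp_reflE linearB linearZ /= coord_simple.
by rewrite (negbTE ij) mulr0 subr0 lt_def ai (forallP pa).
Qed.

Lemma neg_comp_sr a j : a \in Phi -> pos a -> ~~ pos (a \o sr j)%VF -> a = al j.
Proof. by move=> aP pa; apply: contraNeq; apply: pos_comp_sr. Qed.

Lemma sr_conj j s k : (al j \o sw s)%VF = al k -> (sr j \o sw s)%VF = (sw s \o sr k)%VF.
Proof. by move=> e; rewrite (orthogonal_refl (sw_revK s) (@sw_orthogonal s) e). Qed.

(** Follow the sign of [al j] composed with longer and longer prefixes of [s]. Where it flips, at a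
    letter i after a prefix p, the root is [al i] just before, so s_j p = p s_i and this s_i cancels
    the letter i. *)
Lemma exchange j s : ~~ pos (al j \o sw s)%VF ->
  exists2 k, (k < size s)%N & sw (j :: s) = sw (take k s ++ drop k.+1 s).
Proof.
elim/last_ind: s => [|s i IH]; first by rewrite comp_lfun1r pos_simple.
rewrite size_rcons sw_rcons comp_lfunA.
have [pa na|na _] := boolP (pos (al j \o sw s)%VF); last first.
  have [k ks e] := IH na; exists k; first exact: ltnW.
  rewrite -rcons_cons sw_rcons e -sw_rcons -!cats1 takel_cat ?(ltnW ks)//.
  by rewrite drop_cat ltn_neqAle ks andbT; case: eqP => [->|_]; rewrite ?subnn ?drop_size -catA.
exists (size s) => //; rewrite -cats1 take_size_cat// drop_oversize ?cats0 ?size_cat ?addn1//.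
have e := neg_comp_sr (comp_sw_root s (mem_simple j)) pa na.
by rewrite sw_cons sw_cat sw_cons comp_lfun1r comp_lfunA (sr_conj e) -comp_lfunA srK comp_lfun1r.
Qed.

(** Induction on the height. Since (a, a) > 0, some simple root has both a positive coefficient in
    [a] and a positive product with it; if [a] is not simple, reflecting in that root gives a
    positive root b of height smaller by an integer k >= 1, and s_a = s_i s_b s_i. *)
Lemma refl_pos_word a : a \in Phi -> pos a -> exists s, refl dot a = sw s.
Proof.
pose ht a := \sum_i coord alpha i a.
have ht_ge0 b : pos b -> 0 <= ht b by move=> /forallP pb; apply: sumr_ge0.
have [n] : exists n : nat, ht a < n%:R.
  by exists (Num.truncn (ht a)).+1; apply: truncnS_gt.
elim: n a => [|n IH] a an aP pa; first by move: (ht_ge0 _ pa); rewrite leNgt an.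
have [[j ->]|ns] := pselect (exists j, a = al j).
  by exists [:: j]; rewrite sw_cons comp_lfun1r.
have [i ai di] : exists2 i, 0 < coord alpha i a & 0 < ddot dot a (al i).
  apply: contrapT => noi; have := ddot_gt0 dot (neq0_root aP).
  rewrite ddotE {1}(root_coords aP) sum_lfunE.
  apply/negP; rewrite -leNgt; apply: sumr_le0 => i _.
  rewrite scale_lfunE -ddotE /GRing.scale /=.
  have [ai|ai] := ltP 0 (coord alpha i a).
    apply: mulr_ge0_le0; first exact: ltW.
    by rewrite leNgt; apply/negP => di; apply: noi; exists i.
  by have -> : coord alpha i a = 0; [apply/le_anti; rewrite ai (forallP pa)|rewrite mul0r].
have aNi : a != al i by apply/eqP => e; apply: ns; exists i.
pose b := (a \o sr i)%VF.
have bP : b \in Phi by apply: comp_refl_root (mem_simple i) aP.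
have pb : pos b by apply: pos_comp_sr.
have [s es] : exists s, refl dot b = sw s.
  apply: IH => //; rewrite /ht /b comp_reflE.
  have k0 := ddot_gt0 dot (neq0_simple i).
  set k := 2 * ddot dot a (al i) / ddot dot (al i) (al i).
  have k1 : 1 <= k.
    have : 0 < k by rewrite divr_gt0// mulr_gt0.
    have /intrP[m mk] : k \is a Num.int := root_integral rootPhi (mem_simple i) aP.
    by rewrite mk ltr0z ler1z gtz0_ge1.
  have -> : \sum_j coord alpha j (a - k *: al i) = ht a - k.
    under eq_bigr => j _ do rewrite linearB linearZ /= coord_simple.
    rewrite sumrB; congr (_ - _); rewrite (bigD1 i)//= eqxx mulr1 big1 ?addr0// => j ji.
    by rewrite (negbTE ji) mulr0.
  by rewrite ltrBlDr (lt_le_trans an)// -natr1 lerD2l.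
exists (i :: rcons s i); rewrite sw_cons sw_rcons -es.
have ba : (b \o sr i)%VF = a by rewrite /b -comp_lfunA srK comp_lfun1r.
rewrite -(orthogonal_refl (srK i) (refl_orthogonal dot (neq0_simple i)) ba).
by rewrite comp_lfunA srK comp_lfun1l.
Qed.

Lemma weylP w : weyl dot Phi w <-> exists s, sw s = w.
Proof.
split=> [[s sP ->]|[s <-]]; last first.
  by exists [seq al j | j <- s] => // a /mapP[j _ ->]; apply: mem_simple.
elim: s sP => [|a s IH] sP; first by exists [::].
have [|s' es] := IH; first by move=> b bs; apply: sP; rewrite inE bs orbT.
have aP : a \in Phi by apply: sP; rewrite inE eqxx.
have [t et] : exists t, refl dot a = sw t.
  have [pa|na] := boolP (pos a); first exact: refl_pos_word.
  by rewrite -reflN; apply: refl_pos_word; rewrite ?rootN ?posN.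
by exists (t ++ s'); rewrite sw_cat es -et.
Qed.

(** * The group W and its length function *)

Local Notation W := (weyl dot Phi).
Local Notation len := (len dot alpha).
Local Notation redw := (redw dot alpha).

Lemma weyl_sw s : W (sw s).
Proof. by apply/weylP; exists s. Qed.

Lemma weyl1 : W \1%VF.
Proof. exact: (weyl_sw [::]). Qed.

Lemma weyl_sr j : W (sr j).
Proof. by rewrite -[sr j]comp_lfun1r; apply: (weyl_sw [:: j]). Qed.

Lemma weyl_comp u w : W u -> W w -> W (u \o w)%VF.
Proof. by move=> /weylP[s <-] /weylP[s' <-]; rewrite -sw_cat; apply: weyl_sw. Qed.

Lemma weyl_inv w : W w -> W w^-1%VF.
Proof. by move=> /weylP[s <-]; rewrite sw_inv; apply: weyl_sw. Qed.

Lemma weylVK w : W w -> (w^-1 \o w)%VF = \1%VF.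
Proof. by move=> /weylP[s <-]; rewrite sw_inv sw_Krev. Qed.

Lemma weylKV w : W w -> (w \o w^-1)%VF = \1%VF.
Proof. by move=> /weylP[s <-]; rewrite sw_inv sw_revK. Qed.

Lemma weyl_invK w : W w -> (w^-1)^-1%VF = w.
Proof. by move=> /weylP[s <-]; rewrite !sw_inv revK. Qed.

Lemma weyl_inv_comp u w : W u -> W w -> ((u \o w)^-1)%VF = (w^-1 \o u^-1)%VF.
Proof.
by move=> /weylP[s <-] /weylP[s' <-]; rewrite -sw_cat !sw_inv rev_cat sw_cat.
Qed.

Lemma comp_weyl_root a w : W w -> a \in Phi -> (a \o w)%VF \in Phi.
Proof. by move=> /weylP[s <-]; apply: comp_sw_root. Qed.

Lemma redw_reduced w : W w -> reduced_for dot alpha w (redw w).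
Proof.
move=> /weylP[s sw_s]; rewrite /redw; case: xgetP => [s' _ //|noS].
have ex : exists n, `[< exists2 s', sw s' = w & size s' = n >].
  by exists (size s); apply/asboolP; exists s.
have [_ /asboolP[s' s'w <-] minn] := ex_minnP ex.
by case: (noS s'); split=> // s'' s''w; apply: minn; apply/asboolP; exists s''.
Qed.

Lemma sw_redw w : W w -> sw (redw w) = w.
Proof. by move=> /redw_reduced[]. Qed.

Lemma len_sw s : (len (sw s) <= size s)%N.
Proof. by have [_] := redw_reduced (weyl_sw s); apply. Qed.

Lemma len1 : len \1%VF = 0.
Proof. by apply/eqP; rewrite -leqn0; apply: (len_sw [::]). Qed.

Lemma len_eq0 w : W w -> len w = 0 -> w = \1%VF.
Proof. by move=> wW /size0nil e; rewrite -(sw_redw wW) e. Qed.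

Lemma len_inv w : W w -> len w^-1%VF = len w.
Proof.
have le u : W u -> (len u^-1%VF <= len u)%N.
  by move=> uW; rewrite -{1}(sw_redw uW) sw_inv (leq_trans (len_sw _))// size_rev.
move=> wW; apply/eqP; rewrite eqn_leq le//= -{1}(weyl_invK wW) le//.
exact: weyl_inv.
Qed.

Lemma len_comp u w : W u -> W w -> (len (u \o w)%VF <= len u + len w)%N.
Proof.
move=> uW wW; rewrite -{1}(sw_redw uW) -{1}(sw_redw wW) -sw_cat.
by rewrite (leq_trans (len_sw _))// size_cat.
Qed.

Lemma srKl j w : (sr j \o (sr j \o w))%VF = w.
Proof. by rewrite comp_lfunA srK comp_lfun1l. Qed.

Lemma srKr j w : ((w \o sr j) \o sr j)%VF = w.
Proof. by rewrite -comp_lfunA srK comp_lfun1r. Qed.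

Lemma len_sr_le j w : W w -> (len (sr j \o w)%VF <= (len w).+1)%N.
Proof. by move=> wW; rewrite -{1}(sw_redw wW) -sw_cons; apply: len_sw. Qed.

Lemma len_sr_neg j w : W w -> ~~ pos (al j \o w)%VF ->
  len w = (len (sr j \o w)%VF).+1.
Proof.
move=> wW n; apply/eqP; rewrite eqn_leq -{1}(srKl j w) len_sr_le; last first.
  exact: weyl_comp (weyl_sr j) wW.
move: n; rewrite -{1}(sw_redw wW) => /exchange[k ks].
rewrite sw_cons (sw_redw wW) => -> /=; rewrite -[len w]/(size (redw w)).
rewrite (leq_ltn_trans (len_sw _))// size_cat size_takel ?(ltnW ks)// size_drop.
by move: ks; lia.
Qed.

Lemma len_sr_pos j w : W w -> pos (al j \o w)%VF ->
  len (sr j \o w)%VF = (len w).+1.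
Proof.
move=> wW p; have := weyl_comp (weyl_sr j) wW => sW.
have sn : ~~ pos (al j \o (sr j \o w))%VF.
  rewrite comp_lfunA comp_refl_self ?neq0_simple// comp_lfunNl posN ?p//.
  exact: comp_weyl_root (mem_simple j).
by rewrite (len_sr_neg sW sn) srKl.
Qed.

Lemma len_srP j w : W w ->
  len (sr j \o w)%VF = (len w).+1 \/ len w = (len (sr j \o w)%VF).+1.
Proof.
move=> wW; have [p|n] := boolP (pos (al j \o w)%VF).
  by left; apply: len_sr_pos.
by right; apply: len_sr_neg.
Qed.

Lemma sr_inv j : (sr j)^-1%VF = sr j.
Proof. by have := sw_inv [:: j]; rewrite sw_cons comp_lfun1r. Qed.

Lemma len_srrP j w : W w ->
  len (w \o sr j)%VF = (len w).+1 \/ len w = (len (w \o sr j)%VF).+1.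
Proof.
move=> wW; have sW := weyl_comp wW (weyl_sr j).
have e : (w \o sr j)^-1%VF = (sr j \o w^-1)%VF.
  by rewrite weyl_inv_comp ?sr_inv//; apply: weyl_sr.
by have := len_srP j (weyl_inv wW); rewrite -e !len_inv.
Qed.

Lemma weyl_indr (P : 'End(E) -> Prop) : P \1%VF ->
  (forall w j, W w -> len (w \o sr j)%VF = (len w).+1 -> P w -> P (w \o sr j)%VF) ->
  forall w, W w -> P w.
Proof.
move=> P1 PS w; elim: {w}(len w) {-2}w (erefl (len w)) => [|n IH] w lw wW.
  by rewrite (len_eq0 wW lw).
have ew := sw_redw wW; have := lw; rewrite -[len w]/(size (redw w)).
case/lastP: (redw w) ew => // s j; rewrite sw_rcons size_rcons => ew [sn].
have [up|] := len_srrP j (weyl_sw s); last first.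
  by rewrite ew lw => e; have := len_sw s; rewrite e sn ltnNge ltnW.
rewrite -ew; apply: PS => //; first exact: weyl_sw.
by apply: IH; [apply/succn_inj; rewrite -up ew|apply: weyl_sw].
Qed.

Lemma weyl_indl (P : 'End(E) -> Prop) : P \1%VF ->
  (forall w j, W w -> len (sr j \o w)%VF = (len w).+1 -> P w -> P (sr j \o w)%VF) ->
  forall w, W w -> P w.
Proof.
move=> P1 PS w wW; rewrite -(weyl_invK wW); have := weyl_inv wW.
move: {w wW}w^-1%VF => w wW; elim/weyl_indr: w / wW => [|w j wW lw IH].
  by rewrite -[\1%VF^-1%VF]comp_lfun1r weylVK//; apply: weyl1.
have e : (w \o sr j)^-1%VF = (sr j \o w^-1)%VF.
  by rewrite weyl_inv_comp ?sr_inv//; apply: weyl_sr.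
rewrite e; apply: PS => //; first exact: weyl_inv.
by rewrite -e !len_inv//; apply: weyl_comp wW (weyl_sr j).
Qed.

(** The roots need not span the dual, so agreement on them is not enough by itself. But w y - y
    always lies in the span of the vectors representing roots; hence u y - w y lies in that span and
    is also orthogonal to it. *)
Lemma weyl_inj u w : {in Phi, forall a, (a \o u)%VF = (a \o w)%VF} ->
  W u -> W w -> u = w.
Proof.
move=> auw uW wW.
have span s y : exists c : dual, (forall v, (forall a, a \in Phi -> a v = 0) -> c v = 0) /\
    sw s y - y = riesz dot c.
  elim: s => [|j s [c [c0 e]]].
    exists 0; split=> [v _|]; first by rewrite zero_lfunE.
    by rewrite id_lfunE subrr; apply/esym/eqP; rewrite riesz_eq0.
  exists (c - (al j (sw s y) * (2 / ddot dot (al j) (al j))) *: al j); split=> [v v0|].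
    by rewrite add_lfunE opp_lfunE scale_lfunE c0// v0 ?mem_simple// scaler0 subr0.
  apply/esym/riesz_unique => z.
  rewrite sw_cons comp_lfunE reflE addrAC e linearBr /= rieszE.
  by rewrite add_lfunE opp_lfunE scale_lfunE /coroot scalerA linearZr_LR /= rieszE.
apply/lfunP => y; apply/eqP; rewrite -subr_eq0 -(dot_eq0 dot).
move: uW wW auw => /weylP[s <-] /weylP[s' <-] auw.
have [c [c0 e]] := span s y; have [c' [c0' e']] := span s' y.
have v0 a : a \in Phi -> a (sw s y - sw s' y) = 0.
  by move=> aP; rewrite linearB /= -!comp_lfunE auw// subrr.
rewrite [X in dot _ X](_ : _ = riesz dot c - riesz dot c'); last first.
  by rewrite -e -e' opprB subrKA.
by rewrite linearBr /= !rieszE c0// c0'// subrr.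
Qed.

Lemma index_comp_inj u w : W u -> W w ->
  (forall i : 'I_(size Phi), index (Phi`_i \o u)%VF Phi = index (Phi`_i \o w)%VF Phi) ->
  u = w.
Proof.
move=> uW wW e; apply: (weyl_inj _ uW wW) => a aP.
have ia : (index a Phi < size Phi)%N by rewrite index_mem.
have := e (Ordinal ia); rewrite /= (nth_index 0 aP) => {}e.
rewrite -(nth_index 0 (comp_weyl_root uW aP)) e.
exact: nth_index (comp_weyl_root wW aP).
Qed.

(** * Finiteness and the longest element *)

Lemma finite_weyl : finite_set W.
Proof.
apply: (finite_set_bounded (m := size Phi)
  (f := fun w (i : 'I_(size Phi)) => index (Phi`_i \o w)%VF Phi)).
  by move=> w i _; apply: index_size.
exact: index_comp_inj.
Qed.

Definition weyl_enum : seq 'End(E) := fset_set W.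

Lemma mem_weyl_enum w : (w \in weyl_enum) <-> W w.
Proof. by rewrite (in_fset_set finite_weyl) in_setE. Qed.

Lemma uniq_weyl_enum : uniq weyl_enum.
Proof. exact: fset_uniq. Qed.

Lemma sum_weyl (V : nmodType) (f : 'End(E) -> V) :
  \sum_(w \in W) f w = \sum_(w <- weyl_enum) f w.
Proof. exact: fsbig_finite finite_weyl. Qed.

Local Notation w0 := (longest dot alpha Phi).

Lemma longestP : W w0 /\ forall u, W u -> (len u <= len w0)%N.
Proof.
rewrite /longest; case: xgetP => [w _ []//|noW].
have ex : exists n, `[< exists2 w, W w & len w = n >].
  by exists (len \1%VF); apply/asboolP; exists \1%VF => //; apply: weyl1.
have [|_ /asboolP[w wW <-] wmax] := ex_maxnP ex (m := \max_(w <- weyl_enum) len w).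
  by move=> n /asboolP[w /mem_weyl_enum wE <-]; apply: leq_bigmax_seq.
by case: (noW w); split=> // u uW; apply: wmax; apply/asboolP; exists u.
Qed.

Lemma weyl_w0 : W w0. Proof. exact: longestP.1. Qed.

#[local] Hint Resolve weyl1 weyl_sr weyl_sw weyl_w0 : core.

(** A simple root made positive by w0 would make s_j w0 longer than w0. A positive root is a
    nonnegative combination of simple ones, so it becomes negative too. *)
Lemma pos_comp_w0 a : a \in Phi -> pos (a \o w0)%VF = ~~ pos a.
Proof.
have neg_simple j : ~~ pos (al j \o w0)%VF.
  apply/negP => p; have := longestP.2 _ (weyl_comp (weyl_sr j) weyl_w0).
  by rewrite (len_sr_pos weyl_w0 p) ltnn.
have neg_pos b : b \in Phi -> pos b -> ~~ pos (b \o w0)%VF.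
  move=> bP pb; have [i bi] := root_coord_neq0 bP.
  have bwP : (b \o w0)%VF \in Phi by exact: comp_weyl_root weyl_w0 bP.
  rewrite -posN//; apply/forallP => k.
  rewrite linearN /= {1}(root_coords bP) oppr_ge0.
  have -> : ((\sum_(i < r) coord alpha i b *: al i) \o w0)%VF =
      \sum_(i < r) coord alpha i b *: (al i \o w0)%VF.
    by apply/lfunP => y; rewrite comp_lfunE !sum_lfunE; apply: eq_bigr => l _;
      rewrite !scale_lfunE comp_lfunE.
  rewrite linear_sum; apply: sumr_le0 => l _; rewrite linearZ /=.
  apply: mulr_ge0_le0; first exact: (forallP pb).
  have := neg_simple l; rewrite -posN; last exact: comp_weyl_root weyl_w0 (mem_simple l).
  by move=> /forallP/(_ k); rewrite linearN oppr_ge0.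
move=> aP; have [pa|na] := boolP (pos a); first exact/negbTE/neg_pos.
have := neg_pos (- a); rewrite rootN// posN// na => /(_ isT isT).
by rewrite comp_lfunNl posN ?negbK//; apply: comp_weyl_root weyl_w0 aP.
Qed.

(** Each step w to w s_j that lengthens w shortens w^-1 w0, because w0 reverses the sign that
    decides whether s_j lengthens or shortens. *)
Lemma len_invr_w0 w : W w -> (len w + len (w^-1 \o w0)%VF)%N = len w0.
Proof.
move=> wW; elim/weyl_indr: w / wW => [|w j wW lw IH].
  by rewrite len1 -[\1%VF^-1%VF]comp_lfun1r weylVK ?comp_lfun1l//; apply: weyl1.
have vW := weyl_inv wW; have uW := weyl_comp vW weyl_w0.
have eV : ((w \o sr j)^-1)%VF = (sr j \o w^-1)%VF.
  by rewrite weyl_inv_comp ?sr_inv//; apply: weyl_sr.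
have p : pos (al j \o w^-1)%VF.
  apply: contraT => /(len_sr_neg vW); rewrite -eV !len_inv ?lw//; last first.
    exact: weyl_comp wW (weyl_sr j).
  lia.
rewrite eV lw -IH addSnnS -comp_lfunA -(len_sr_neg uW)// comp_lfunA.
by rewrite pos_comp_w0 ?p ?comp_weyl_root ?mem_simple.
Qed.

(** The length formula at the inverse of w0 leaves length 0 for w0 w0. *)
Lemma w0_inv : w0^-1%VF = w0.
Proof.
have := len_invr_w0 (weyl_inv weyl_w0).
rewrite (weyl_invK weyl_w0) (len_inv weyl_w0) -{2}[len w0]addn0.
move=> /addnI/(len_eq0 (weyl_comp weyl_w0 weyl_w0)) e.
by rewrite -[RHS]comp_lfun1l -(weylVK weyl_w0) -comp_lfunA e comp_lfun1r.
Qed.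

(** * Reduced words and Matsumoto's theorem *)

Definition reduced s := size s = len (sw s).

Lemma redw_word w : W w -> reduced (redw w).
Proof. by move=> wW; rewrite /reduced (sw_redw wW). Qed.

Lemma reduced_cat s s' : reduced (s ++ s') -> reduced s /\ reduced s'.
Proof.
rewrite /reduced size_cat sw_cat => e.
have := len_comp (weyl_sw s) (weyl_sw s'); rewrite -e.
have := len_sw s; have := len_sw s'; lia.
Qed.

Lemma reduced_cons j s : reduced (j :: s) -> reduced s.
Proof. by rewrite -cat1s => /reduced_cat[]. Qed.

Lemma reduced_rcons j s : reduced (rcons s j) -> reduced s.
Proof. by rewrite -cats1 => /reduced_cat[]. Qed.

Fixpoint alt i j m : seq 'I_r := if m is m'.+1 then i :: alt j i m' else [::].

Lemma size_alt i j m : size (alt i j m) = m.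
Proof. by elim: m i j => //= m IH i j; rewrite IH. Qed.

Lemma take_alt k m i j : (k <= m)%N -> take k (alt i j m) = alt i j k.
Proof. by elim: k m i j => [|k IH] [|m] i j //= km; rewrite ?take0// IH. Qed.

Local Notation pow i j k := (sw (flatten (nseq k [:: i; j]))).

Lemma powS i j k : pow i j k.+1 = (sr i \o (sr j \o pow i j k))%VF.
Proof. by []. Qed.

Lemma sr_pow i j k : (sr i \o pow j i k)%VF = (pow i j k \o sr i)%VF.
Proof.
elim: k => [|k IH]; first by rewrite comp_lfun1l comp_lfun1r.
by rewrite !powS IH !comp_lfunA.
Qed.

(* [s_i s_j s_i ...] = (s_i s_j)^m (s_j s_i s_j ...), with [m] letters each. *)
Lemma sw_alt_pow i j m : (pow i j m \o sw (alt j i m))%VF = sw (alt i j m).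
Proof.
elim: m i j => [|m IH] i j; first by rewrite comp_lfun1l.
by rewrite powS sr_pow [alt _ _ _]/= !sw_cons -!comp_lfunA srKl IH.
Qed.

Lemma pow1_alt i j m : pow i j m = \1%VF <-> sw (alt i j m) = sw (alt j i m).
Proof.
rewrite -sw_alt_pow; split=> [->|e]; first by rewrite comp_lfun1l.
by apply: (@sw_injr (alt j i m)); rewrite comp_lfun1l.
Qed.

(** If (s_i s_j)^(k+1) were already 1, the two alternating words with k+1 letters would agree; then
    the prefix of k+2 letters would cancel its first letter and shrink to k letters, although it is
    reduced. *)
Lemma refl_order_alt i j m : (0 < m)%N -> reduced (alt i j m) ->
  sw (alt i j m) = sw (alt j i m) -> refl_order dot alpha i j m.
Proof.
move=> m0 red e; split=> //; first exact/pow1_alt.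
move=> [//|k] /andP[_ km] /pow1_alt ek.
have : reduced (alt i j k.+2).
  by move: red; rewrite -{1}(cat_take_drop k.+2 (alt i j m)) take_alt// => /reduced_cat[].
rewrite /reduced size_alt [alt _ _ _]/= -[_ :: alt i j k]/(alt j i k.+1) sw_cons -ek.
rewrite [alt _ _ _]/= sw_cons srKl => ek'.
by have := len_sw (alt j i k); rewrite -ek' size_alt ltnNge ltnW.
Qed.

(** The word [j :: b] shows that s_j shortens [sw a], so the exchange condition trades some letter
    of [a] for a [j] in front. *)
Lemma reduced_swap j (a b : seq 'I_r) : reduced a -> reduced (j :: b) ->
  sw a = sw (j :: b) -> exists2 k, (k < size a)%N &
  let u := j :: (take k a ++ drop k.+1 a) in reduced u /\ sw u = sw a.
Proof.
move=> ra rb ab; have sab : size a = (size b).+1 by rewrite ra ab -rb.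
have n : ~~ pos (al j \o sw a)%VF.
  apply/negP => /(len_sr_pos (weyl_sw a)); rewrite -ra sab ab sw_cons srKl.
  by have := len_sw b; lia.
have [k ka e] := exchange n; exists k => //=.
have e' : sw (j :: take k a ++ drop k.+1 a) = sw a by rewrite sw_cons -e sw_cons srKl.
split=> //; rewrite /reduced e' -ra /= size_cat size_takel ?(ltnW ka)// size_drop; lia.
Qed.

Section Matsumoto.
Variables (H : pzRingType) (T : 'I_r -> H).
Hypothesis braid : forall i j m, refl_order dot alpha i j m ->
  alternating T i j m = alternating T j i m.

Local Notation f s := (\prod_(j <- s) T j).

Lemma prod_alt i j m : f (alt i j m) = alternating T i j m.
Proof. by elim: m i j => [|m IH] i j; rewrite ?big_nil//= big_cons IH. Qed.

(* Replacing one word of a pair with different products by the first letter of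
   the other, followed by the first word without its last letter, keeps the
   products different, so both words can be made alternating. *)
Lemma matsumoto (a b : seq 'I_r) : reduced a -> reduced b -> sw a = sw b -> f a = f b.
Proof.
elim: {a}(size a) {-2}a (erefl (size a)) b => [|n IH] a sa b ra rb ab.
  have /size0nil -> : size b = 0 by rewrite rb -ab -ra.
  by rewrite (size0nil sa).
have size_ab c : reduced c -> sw c = sw a -> size c = n.+1 by move=> -> ->; rewrite -ra.
have same_head j c d : reduced (j :: c) -> reduced (j :: d) ->
    sw (j :: c) = sw a -> sw (j :: d) = sw a -> f (j :: c) = f (j :: d).
  move=> rc rd ca da; rewrite !big_cons; congr (_ * _).
  apply: IH (reduced_cons rc) (reduced_cons rd) _; first by have [] := size_ab _ rc ca.
  by apply: (@sw_inj [:: j]); rewrite -!sw_cat ca.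
have same_last c d j : reduced (rcons c j) -> reduced (rcons d j) ->
    sw (rcons c j) = sw a -> sw (rcons d j) = sw a -> f (rcons c j) = f (rcons d j).
  move=> rc rd ca da; rewrite !big_rcons; congr (_ * _).
  apply: IH (reduced_rcons rc) (reduced_rcons rd) _.
    by have := size_ab _ rc ca; rewrite size_rcons => -[].
  by apply: (@sw_injr [:: j]); rewrite -!sw_cat !cats1 ca.
have step j c d : reduced c -> reduced (j :: d) -> sw c = sw a -> sw (j :: d) = sw a ->
    f c <> f (j :: d) -> let t := j :: take n c in
    [/\ reduced t, sw t = sw a & f t = f (j :: d)].
  move=> rc rd ca da fcd.
  have sc := size_ab _ rc ca; have [k] := reduced_swap rc rd (etrans ca (esym da)).
  (* If the letter given up is the last one of [c], the exchanged word is the one claimed. If it is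
     an earlier one, the exchanged word shares its head with [j :: d] and its last letter with [c],
     so by induction the two products agree, against [fcd]. *)
  rewrite sc ltnS leq_eqVlt => /orP[/eqP->|kn] /= [ru ua].
    rewrite drop_oversize ?sc// cats0 in ru ua.
    by split=> //; [rewrite ua|apply: same_head; rewrite ?ua].
  case: fcd; have <- : f (j :: take k c ++ drop k.+1 c) = f (j :: d).
    by apply: same_head; rewrite ?ua.
  have [c' [x ec]] : exists c' x, c = rcons c' x.
    by case/lastP: c {rc ca ru ua} sc => // c' x _; exists c', x.
  have sc' : size c' = n by move: sc; rewrite ec size_rcons => -[].
  move: rc ca ru ua; rewrite ec drop_rcons ?sc'// -rcons_cat -rcons_cons => rc ca ru ua.
  exact: same_last (etrans ua ca).
apply: contrapT => fab.
have alts k : (k <= n)%N -> exists i j c d,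
    [/\ [/\ reduced c, sw c = sw a & take k.+1 c = alt i j k.+1],
        [/\ reduced d, sw d = sw a & take k.+1 d = alt j i k.+1] & f c <> f d].
  elim: k => [_|k IHk kn].
    have sb := size_ab _ rb (esym ab).
    case: a b sa sb ra rb ab fab {IH same_head same_last step size_ab} => // i c [|j d] // _ _ ra rb ab fab.
    by exists i, j, (i :: c), (j :: d); rewrite /= !take0.
  have [i [j [c [d [[rc ca tc] [rd da td] fcd]]]]] := IHk (ltnW kn).
  case: c tc rc ca fcd => // i' c [ei tc] rc ca fcd; rewrite {}ei in rc ca fcd.
  case: d td rd da fcd => // j' d [ej td] rd da fcd; rewrite {}ej in rd da fcd.
  have [rt ta ft] := step _ _ _ rc rd ca da fcd.
  have [ru ua fu] := step _ _ _ rd rc da ca (nesym fcd).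
  exists i, j, (i :: take n (j :: d)), (j :: take n (i :: c)).
  rewrite ft fu; split=> //; split=> //.
    by rewrite -[take k.+2 _]/(i :: take k.+1 _) take_takel// /= td.
  by rewrite -[take k.+2 _]/(j :: take k.+1 _) take_takel// /= tc.
have [i [j [c [d [[rc ca tc] [rd da td] fcd]]]]] := alts n (leqnn n).
rewrite take_oversize ?(size_ab _ rc)// in tc.
rewrite take_oversize ?(size_ab _ rd)// in td.
case: fcd; rewrite tc td !prod_alt; apply: braid.
by apply: refl_order_alt; rewrite -?tc -?td ?ca.
Qed.

End Matsumoto.

(** * Reindexing sums over W by a simple reflection *)

Lemma sum_weyl_srl (V : nmodType) j (f : 'End(E) -> V) :
  \sum_(w <- weyl_enum) f (sr j \o w)%VF = \sum_(w <- weyl_enum) f w.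
Proof.
have e : perm_eq [seq (sr j \o w)%VF | w <- weyl_enum] weyl_enum.
  apply: uniq_perm; rewrite ?uniq_weyl_enum ?map_inj_uniq ?uniq_weyl_enum//.
    by move=> u w /(congr1 (fun v => sr j \o v)%VF); rewrite !srKl.
  move=> w; apply/mapP/idP => [[u /mem_weyl_enum uW ->]|/mem_weyl_enum wW].
    by apply/mem_weyl_enum/weyl_comp => //; apply: weyl_sr.
  exists (sr j \o w)%VF; last by rewrite srKl.
  by apply/mem_weyl_enum/weyl_comp => //; apply: weyl_sr.
by rewrite -[RHS](perm_big _ e) big_map.
Qed.

Lemma sum_weyl_srr (V : nmodType) j (f : 'End(E) -> V) :
  \sum_(w <- weyl_enum) f (w \o sr j)%VF = \sum_(w <- weyl_enum) f w.
Proof.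
have e : perm_eq [seq (w \o sr j)%VF | w <- weyl_enum] weyl_enum.
  apply: uniq_perm; rewrite ?uniq_weyl_enum ?map_inj_uniq ?uniq_weyl_enum//.
    by move=> u w /(congr1 (fun v => v \o sr j)%VF); rewrite !srKr.
  move=> w; apply/mapP/idP => [[u /mem_weyl_enum uW ->]|/mem_weyl_enum wW].
    by apply/mem_weyl_enum/weyl_comp => //; apply: weyl_sr.
  exists (w \o sr j)%VF; last by rewrite srKr.
  by apply/mem_weyl_enum/weyl_comp => //; apply: weyl_sr.
by rewrite -[RHS](perm_big _ e) big_map.
Qed.

(** * The Weyl group action on the group algebra of a lattice *)

Variables (F : fieldType) (L : zmodClosed E).
Hypothesis lattL : root_lattice dot Phi L.
Local Notation A := (galg F (latt L)).
Implicit Types (l k : latt L) (f g : A).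

Lemma latt_torsion_free l n : l *+ n.+1 = 0 -> l = 0.
Proof.
move=> /(congr1 val); rewrite raddfMn raddf0 -scaler_nat => /eqP.
by rewrite scaler_eq0 pnatr_eq0 => /eqP l0; apply: val_inj; rewrite raddf0.
Qed.

Lemma coroot_mem a : a \in Phi -> coroot dot a \in L.
Proof.
move=> aP; apply: (lattice_coroot lattL).
have ia : (index a Phi < size Phi)%N by rewrite index_mem.
exists [ffun i : 'I_(size Phi) => (i == Ordinal ia)%:R]; rewrite (bigD1 (Ordinal ia))//=.
rewrite big1 ?addr0 => [|i ij]; rewrite ffunE ?eqxx ?mulr1z.
  by rewrite (nth_map 0) ?nth_index.
by rewrite (negbTE ij) mulr0z.
Qed.

Lemma refl_mem a v : a \in Phi -> v \in L -> refl dot a v \in L.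
Proof.
move=> aP vL; rewrite reflE rpredB//.
have /intrP[m ->] := lattice_integral lattL aP vL.
by rewrite scaler_int rpredMz ?coroot_mem.
Qed.

Lemma weyl_mem w v : W w -> v \in L -> w v \in L.
Proof.
move=> /weylP[s <-] vL.
elim: s => [|j s IH]; first by rewrite id_lfunE.
by rewrite sw_cons comp_lfunE refl_mem// mem_simple.
Qed.

Lemma val_lact w l : W w -> val (lact w l) = w (val l).
Proof. by move=> wW; rewrite insubdK//; apply: weyl_mem wW (valP l). Qed.

Lemma val_lcoroot j : val (lcoroot dot alpha L j) = coroot dot (al j).
Proof. by rewrite insubdK//; apply/coroot_mem/mem_simple. Qed.

Lemma lact_comp u w l : W u -> W w -> lact (u \o w)%VF l = lact u (lact w l).
Proof.
move=> uW wW; apply: val_inj; rewrite val_lact ?comp_lfunE ?val_lact//.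
exact: weyl_comp uW wW.
Qed.

Lemma lactD w : W w -> {morph @lact R E L w : k l / k + l}.
Proof. by move=> wW k l; apply: val_inj; rewrite val_lact// !raddfD /= !val_lact. Qed.

Lemma lact1 l : lact \1%VF l = l.
Proof. by apply: val_inj; rewrite val_lact ?id_lfunE//; apply: weyl1. Qed.

Lemma gact_exp w l : gact w (gexp F l) = gexp F (lact w l).
Proof. exact: gmap_exp. Qed.

HB.instance Definition _ w := GRing.Linear.copy (@gact R E F L w) (gmap (lact w)).

Lemma gactM w f g : W w -> gact w (f * g) = gact w f * gact w g.
Proof. by move=> /lactD; apply: gmapM. Qed.

Lemma gact1 w : W w -> gact w 1 = 1 :> A.
Proof.
move=> wW; rewrite -gexp0 gact_exp; congr gexp.
by apply: val_inj; rewrite val_lact// !raddf0.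
Qed.

Lemma gact_comp u w f : W u -> W w -> gact (u \o w)%VF f = gact u (gact w f).
Proof.
by move=> uW wW; rewrite /gact gmap_comp; apply: eq_gmap => l; rewrite /= lact_comp.
Qed.

Lemma gact_id f : gact \1%VF f = f.
Proof. by rewrite -[RHS]gmap_id; apply: eq_gmap => l; rewrite lact1. Qed.

Lemma gact_inj w : W w -> injective (@gact R E F L w).
Proof.
move=> wW f g e; rewrite -[f]gact_id -[g]gact_id.
rewrite -(weylVK wW).
by rewrite !gact_comp ?e//; apply: weyl_inv.
Qed.

Lemma gact_lreg w f : W w -> GRing.lreg f -> GRing.lreg (gact w f).
Proof.
move=> wW fr; have vW := weyl_inv wW.
apply: mulrI0_lreg => g /(congr1 (gact w^-1%VF)); rewrite linear0 gactM//.
rewrite -gact_comp// (weylVK wW) gact_id -[RHS](mulr0 f).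
by move=> /fr e; apply: (gact_inj vW); rewrite e linear0.
Qed.

Lemma giota_exp l : giota (gexp F l) = gexp F (- l).
Proof. exact: gmap_exp. Qed.

Lemma giotaM f g : giota (f * g) = giota f * giota g.
Proof. by apply: gmapM => k l; rewrite opprD. Qed.

HB.instance Definition _ := GRing.Linear.copy (@giota F (latt L)) (gmap -%R).

Lemma giotaP (d e : F) f g : giota (d *: f + e *: g) = d *: giota f + e *: giota g.
Proof. by rewrite linearP; congr (_ + _); apply: linearZ. Qed.

Lemma giotaB f g : giota (f - g) = giota f - giota g.
Proof. exact: linearB. Qed.

Lemma giotaN f : giota (- f) = - giota f.
Proof. exact: linearN. Qed.

Lemma giotaZ d f : giota (d *: f) = d *: giota f.
Proof. exact: linearZ. Qed.

Lemma giotaK : involutive (@giota F (latt L)).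
Proof.
move=> f; rewrite /giota gmap_comp -[RHS]gmap_id; apply: eq_gmap => l /=.
by rewrite opprK.
Qed.

Lemma gact_giota w f : W w -> gact w (giota f) = giota (gact w f).
Proof.
move=> wW; rewrite /gact /giota !gmap_comp; apply: eq_gmap => l /=.
by apply: val_inj; rewrite val_lact// !raddfN /= val_lact.
Qed.

(** * The divided differences [nabla] *)

Local Notation xa j := (gexp F (lcoroot dot alpha L j)).

Lemma lcoroot_neq0 j : lcoroot dot alpha L j != 0.
Proof.
apply/eqP => /(congr1 val); rewrite val_lcoroot raddf0 => e.
have := coroot_self dot (neq0_simple j).
by rewrite e linear0 => /esym/eqP; rewrite pnatr_eq0.
Qed.

Lemma lreg_xa_sub (c d : F) j : c != 0 -> d != 0 ->
  GRing.lreg (c *: xa j - d%:A : A).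
Proof.
move=> c0 d0; rewrite -scaleNr -gexp0.
by apply: (lreg_gexp2 latt_torsion_free); rewrite ?oppr_eq0// lcoroot_neq0.
Qed.

Lemma lreg_xa_sub1 j : GRing.lreg (xa j - 1 : A).
Proof.
by have := @lreg_xa_sub 1 1 j (oner_neq0 F) (oner_neq0 F); rewrite !scale1r.
Qed.

Lemma dvd_gexp_sub l k (m : int) :
  exists g : A, g * (gexp F k - 1) = gexp F (l + k *~ m) - gexp F l.
Proof.
have nat_case n l' : exists g : A, g * (gexp F k - 1) = gexp F (l' + k *+ n) - gexp F l'.
  elim: n => [|n [g e]]; first by exists 0; rewrite mul0r mulr0n addr0 subrr.
  exists (gexp F (l' + k *+ n) + g); rewrite mulrDl e mulrBr mulr1 -gexpD -(addrA l') -mulrSr.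
  by rewrite subrKA.
case: m => n; first exact: nat_case.
(* For a negative multiple, run the geometric sum upwards from the other end and change the sign. *)
have [g e] := nat_case n.+1 (l - k *+ n.+1).
by exists (- g); rewrite mulNr e opprB subrK NegzE mulrNz.
Qed.

Lemma nabla_ex j f : exists g, g * (xa j - 1) = gact (sr j) f - f.
Proof.
elim/galg_ind: f => [|c l f [g e]]; first by exists 0; rewrite linear0 mul0r subr0.
have [m em] : exists m : int, al j (val l) = m%:~R.
  by have /intrP := lattice_integral lattL (mem_simple j) (valP l).
have [h eh] := dvd_gexp_sub l (lcoroot dot alpha L j) (- m).
have lE : lact (sr j) l = l + lcoroot dot alpha L j *~ - m.
  have vD k k' : val (k + k' *~ - m) = val k + val k' *~ - m.
    by rewrite raddfD; congr (_ + _); apply: raddfMz.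
  apply: val_inj; rewrite (val_lact _ (weyl_sr j)) reflE em vD.
  by rewrite val_lcoroot mulrNz scaler_int.
exists (c *: h + g); rewrite mulrDl e -scalerAl eh linearP /= gact_exp lE.
by rewrite scalerBr opprD addrACA.
Qed.

Lemma nablaP j f : nabla dot alpha j f * (xa j - 1) = gact (sr j) f - f.
Proof.
by rewrite /nabla; case: xgetP => // no; have [g e] := nabla_ex j f; case: (no g).
Qed.

Lemma nabla_unique j f g : g * (xa j - 1) = gact (sr j) f - f -> nabla dot alpha j f = g.
Proof. by rewrite -nablaP ![_ * (xa j - 1)]mulrC => /lreg_xa_sub1. Qed.

Lemma nabla_is_linear j : linear (nabla dot alpha j : A -> A).
Proof.
move=> c f g; apply: nabla_unique; rewrite mulrDl -scalerAl !nablaP linearP /=.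
by rewrite scalerBr opprD addrACA.
Qed.

HB.instance Definition _ j :=
  GRing.isLinear.Build F A A *:%R (nabla dot alpha j) (nabla_is_linear j).

Lemma gact_srK j f : gact (sr j) (gact (sr j) f) = f.
Proof.
by rewrite -(gact_comp _ (weyl_sr j) (weyl_sr j)) (srK) gact_id.
Qed.

Lemma nabla_gact j f : nabla dot alpha j (gact (sr j) f) = - nabla dot alpha j f.
Proof. by apply: nabla_unique; rewrite mulNr nablaP gact_srK opprB. Qed.

(** With x = x^{alpha_j^vee}, iota changes the denominator x - 1 into x^-1 - 1 = -x^-1 (x - 1). So
    the left side is -x nabla_j f = -(x - 1) nabla_j f - nabla_j f. *)
Lemma giota_nabla j f : giota (nabla dot alpha j (giota f)) =
  f - gact (sr j) f - nabla dot alpha j f.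
Proof.
have sW := weyl_sr j.
apply: (@lreg_xa_sub1 j).
rewrite mulrBr ![(xa j - 1) * _]mulrC nablaP.
have xNx : gexp F (- lcoroot dot alpha L j) * xa j = 1.
  by rewrite -gexpD addNr gexp0.
have e : giota (nabla dot alpha j (giota f)) *
    (gexp F (- lcoroot dot alpha L j) - 1) = gact (sr j) f - f.
  have := congr1 (@giota _ _) (nablaP j (giota f)).
  rewrite giotaM !linearB /= gact_giota// !giotaK giota_exp.
  by rewrite -[1 : A]gexp0 giota_exp oppr0.
have := congr1 ( *%R (xa j)) e; move: (giota (nabla _ _ _ _)) => G.
rewrite mulrCA mulrBr mulr1 -gexpD subrr gexp0 => eG.
by rewrite -[LHS]opprK -mulrN opprB eG; ring.
Qed.

(** The lattice contains the coroots, so for a root [a] the roots [a \o u] and [a \o w] have the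
    same product with every root. In particular their difference is orthogonal to both of them,
    hence to itself. *)
Lemma lact_weyl_inj u w : W u -> W w -> (forall l, lact u l = lact w l) -> u = w.
Proof.
move=> uW wW e; apply: (weyl_inj) (uW) (wW) => a aP.
have [bP cP] : (a \o u)%VF \in Phi /\ (a \o w)%VF \in Phi.
  by split; apply: (comp_weyl_root).
have eL b : b \in Phi -> u (coroot dot b) = w (coroot dot b).
  move=> /coroot_mem bL; have := congr1 val (e (Latt bL)).
  by rewrite !val_lact.
have eR b : b \in Phi -> ddot dot (a \o u)%VF b = ddot dot (a \o w)%VF b.
  move=> bP'; have := app_coroot dot b (a \o u)%VF; rewrite comp_lfunE eL// -comp_lfunE.
  have b0 := lt0r_neq0 (ddot_gt0 dot (neq0_root bP')).
  by rewrite app_coroot => /(mulIf (invr_neq0 b0))/mulfI-> //; rewrite pnatr_eq0.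
move: bP cP eR; move: (a \o u)%VF (a \o w)%VF => b c bP cP eR.
apply/eqP; rewrite -subr_eq0 -(riesz_eq0 dot) -(dot_eq0 dot); apply/eqP.
have -> : riesz dot (b - c) = riesz dot b - riesz dot c.
  by apply: riesz_unique => y; rewrite linearBr /= !rieszE add_lfunE opp_lfunE.
rewrite linearBr /= !rieszE !linearB /= -!ddotE -!(eR _ bP) -!(eR _ cP).
by rewrite !subrr.
Qed.

(* Dedekind's argument: combining the relations at [l] and at [l + k] removes
   one term and multiplies the others by nonzero differences of characters. *)
Lemma gact_independent (s : seq 'End(E)) (e : 'End(E) -> A) : uniq s ->
  (forall u, u \in s -> W u) ->
  (forall f, \sum_(u <- s) e u * gact u f = 0) -> forall u, u \in s -> e u = 0.
Proof.
elim: s e => // v s IH e /= /andP[vs us] sW rel.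
have vW : W v by apply: sW; rewrite inE eqxx.
have sW' u : u \in s -> W u by move=> su; apply: sW; rewrite inE su orbT.
have e0 u : u \in s -> e u = 0.
  move=> su; have uW := sW' _ su.
  have [k ek] : exists k, lact u k != lact v k.
    apply: contrapT => no; move: vs; have -> : v = u; last by rewrite su.
    apply: lact_weyl_inj => // k; apply/esym/eqP; apply: contrapT => /negP ne.
    by apply: no; exists k.
  have reg : GRing.lreg (gexp F (lact u k) - gexp F (lact v k) : A).
    have := lreg_gexp2 latt_torsion_free (oner_neq0 F) (_ : - 1 != 0 :> F) ek.
    by rewrite scale1r scaleN1r; apply; rewrite oppr_eq0 oner_eq0.
  apply: reg; rewrite mulr0 mulrC.
  apply: (IH (fun w => e w * (gexp F (lact w k) - gexp F (lact v k))) us sW' _ u su) => f.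
  have := rel (gexp F k * f); have := congr1 ( *%R (gexp F (lact v k))) (rel f).
  rewrite !big_cons mulr0 mulrDr gactM// gact_exp => /eqP; rewrite addr_eq0 => /eqP r1.
  rewrite mulrCA r1 addrC => /eqP; rewrite subr_eq0 => /eqP r2.
  transitivity (\sum_(w <- s) (e w * gact w (gexp F k * f) - gexp F (lact v k) * (e w * gact w f))).
    rewrite [LHS]big_seq [RHS]big_seq; apply: eq_bigr => w ws.
    by have wW := sW' _ ws; rewrite gactM// gact_exp; ring.
  by rewrite sumrB -mulr_sumr r2 subrr.
move=> u; rewrite inE => /predU1P[->|]; last exact: e0.
have := rel 1; rewrite big_cons big_seq big1 => [|w ws]; last by rewrite e0 ?mul0r.
by rewrite addr0 gact1// mulr1.
Qed.

(** * The affine Hecke algebra *)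

Variables (t : dual -> F).
Variables (H : unitAlgType F) (T : 'I_r -> H) (X : latt L -> H).
Variable pi : H -> galg F (latt L) -> galg F (latt L).
Hypothesis inv_t : weyl_invariant dot Phi t.
Hypothesis heckeH : hecke_relations dot alpha t T X.
Hypothesis rep_pi : polynomial_rep dot alpha t T X pi.

Local Notation We := weyl_enum.
Local Notation Tw := (Tw dot alpha T).
Local Notation tw := (tw dot alpha t).
Local Notation tj := (tj alpha t).
Local Notation nabla := (nabla dot alpha).
Local Notation c j := (tj j - (tj j)^-1).

Lemma tj_neq0 j : tj j != 0.
Proof. exact: (inv_t (mem_simple j)).1. Qed.

Lemma T_sqr j : T j * T j = c j *: T j + 1.
Proof.
have := hecke_quadratic heckeH j.
rewrite mulrDr !mulrBl mulr_algr mulr_algl -scalerAl mulr_algr scalerA divff ?tj_neq0//.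
rewrite scale1r addrAC addrA => /eqP; rewrite subr_eq0 => /eqP e.
by rewrite scalerBl -e [_ - 1 - _]addrAC addrK subrK.
Qed.

Lemma T_mulV j : T j * (T j - (c j)%:A) = 1.
Proof. by rewrite mulrBr mulr_algr T_sqr addrC addKr. Qed.

Lemma T_Vmul j : (T j - (c j)%:A) * T j = 1.
Proof. by rewrite mulrBl mulr_algl T_sqr addrC addKr. Qed.

Lemma unit_T j : T j \is a GRing.unit.
Proof. by apply/unitrP; exists (T j - (c j)%:A); rewrite T_mulV T_Vmul. Qed.

Lemma T_inv j : (T j)^-1 = T j - (c j)%:A.
Proof. by apply: (mulrI (unit_T j)); rewrite T_mulV mulrV ?unit_T. Qed.

Lemma Tw_word s : reduced s -> Tw (sw s) = \prod_(j <- s) T j.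
Proof.
move=> rs; apply: (matsumoto (hecke_braid heckeH)) => //.
  exact: redw_word.
exact: sw_redw.
Qed.

Lemma Tw1 : Tw \1%VF = 1.
Proof.
rewrite -[\1%VF]/(sw [::]) Tw_word ?big_nil//.
by rewrite /reduced (len1).
Qed.

Lemma Tw_up j w : W w -> len (sr j \o w)%VF = (len w).+1 ->
  Tw (sr j \o w)%VF = T j * Tw w.
Proof.
move=> wW up; have e := sw_redw wW.
rewrite -{1}e -sw_cons Tw_word ?big_cons//.
by rewrite /reduced sw_cons e up.
Qed.

Lemma Tw_upr j w : W w -> len (w \o sr j)%VF = (len w).+1 ->
  Tw (w \o sr j)%VF = Tw w * T j.
Proof.
move=> wW up; have e := sw_redw wW.
rewrite -{1}e -sw_rcons Tw_word ?big_rcons//.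
by rewrite /reduced sw_rcons e up size_rcons.
Qed.

Definition left_descent j w := (len (sr j \o w)%VF < len w)%N.
Definition right_descent j w := (len (w \o sr j)%VF < len w)%N.

Lemma T_mul_Tw j w : W w ->
  T j * Tw w = Tw (sr j \o w)%VF + (if left_descent j w then c j else 0) *: Tw w.
Proof.
move=> wW; have uW := weyl_comp (weyl_sr j) wW.
rewrite /left_descent; have [up|dn] := len_srP j wW.
  by rewrite up ltnNge leqnSn /= scale0r addr0 Tw_up.
rewrite dn ltnSn; have := Tw_up (j := j) uW; rewrite srKl => /(_ dn) ->.
by rewrite mulrA T_sqr mulrDl -scalerAl mul1r addrC.
Qed.

Lemma Tw_mul_T j w : W w ->
  Tw w * T j = Tw (w \o sr j)%VF + (if right_descent j w then c j else 0) *: Tw w.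
Proof.
move=> wW; have uW := weyl_comp wW (weyl_sr j).
rewrite /right_descent; have [up|dn] := len_srrP j wW.
  by rewrite up ltnNge leqnSn /= scale0r addr0 Tw_upr.
rewrite dn ltnSn; have := Tw_upr (j := j) uW; rewrite srKr => /(_ dn) ->.
by rewrite -mulrA T_sqr mulrDr -scalerAr mulr1 addrC.
Qed.

Local Notation Xf := (glin X).

Lemma Xf_exp l : Xf (gexp F l) = X l.
Proof. exact: glin_exp. Qed.

Lemma XfP (d e : F) f g : Xf (d *: f + e *: g) = d *: Xf f + e *: Xf g.
Proof. by rewrite linearP; congr (_ + _); apply: linearZ. Qed.

Lemma T_mul_Xf j f : T j * Xf f = Xf (gact (sr j) f) * T j + c j *: Xf (nabla j f).
Proof.
elim/galg_ind: f => [|d l f IH]; first by rewrite !linear0 mulr0 mul0r add0r ?scaler0.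
rewrite [gact _ _]linearP [nabla _ _]linearP !linearP mulrDr mulrDl IH.
rewrite /= -scalerAr -scalerAl !Xf_exp gact_exp Xf_exp.
have /eqP := hecke_cross heckeH j l; rewrite subr_eq => /eqP ->.
by rewrite scalerDr [in LHS](addrC (d *: (c j *: _))) addrACA.
Qed.

Lemma Xf_mul_T j f : Xf f * T j = T j * Xf (gact (sr j) f) + c j *: Xf (nabla j f).
Proof. by rewrite T_mul_Xf gact_srK nabla_gact !linearN /= subrK. Qed.

(** * The polynomial representation *)

HB.instance Definition _ h := GRing.isLinear.Build F A A *:%R (pi h) (rep_linear rep_pi h).

Lemma pi_linearl f d (g h : H) : pi (d *: g + h) f = d *: pi g f + pi h f.
Proof. exact: (rep_linearl rep_pi f). Qed.

Lemma piZl f d (h : H) : pi (d *: h) f = d *: pi h f.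
Proof.
have pi0 : pi 0 f = 0 by have := pi_linearl f (- 1) 0 0; rewrite scaler0 addr0 scaleN1r addNr.
by rewrite -[d *: h]addr0 pi_linearl pi0 addr0.
Qed.

Lemma piDl f (g h : H) : pi (g + h) f = pi g f + pi h f.
Proof. by rewrite -[g]scale1r pi_linearl !scale1r. Qed.

Lemma pi_suml f (I : Type) (s : seq I) (h : I -> H) :
  pi (\sum_(i <- s) h i) f = \sum_(i <- s) pi (h i) f.
Proof.
elim: s => [|i s IH]; last by rewrite !big_cons piDl IH.
by rewrite !big_nil -(scale0r 0) piZl scale0r.
Qed.

Lemma pi_Xf g f : pi (Xf g) f = g * f.
Proof.
elim/galg_ind: g => [|d l g IH]; first by rewrite linear0 mul0r -(scale0r 0) piZl scale0r.
by rewrite linearP pi_linearl IH /= Xf_exp (rep_x rep_pi) mulrDl scalerAl.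
Qed.

Lemma pi_mulVK h f : h \is a GRing.unit -> pi h (pi h^-1 f) = f.
Proof. by move=> hu; rewrite -(repM rep_pi) divrr// (rep1 rep_pi). Qed.

Lemma piZr h d f : pi h (d *: f) = d *: pi h f.
Proof. exact: linearZ. Qed.

Lemma piNr h f : pi h (- f) = - pi h f.
Proof. exact: linearN. Qed.

Lemma pi_T_one j : pi (T j) 1 = (tj j)%:A.
Proof.
rewrite (rep_T rep_pi) (gact1 (weyl_sr j)) (_ : nabla j 1 = 0) ?scaler0 ?addr0//.
by apply: nabla_unique; rewrite (gact1 (weyl_sr j)) subrr mul0r.
Qed.

Lemma pi_Tw_one w : pi (Tw w) 1 = (tw w)%:A.
Proof.
rewrite /Defs.Tw /Defs.tw; elim: (redw w) => [|j s IH].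
  by rewrite !big_nil (rep1 rep_pi) scale1r.
rewrite !big_cons (repM rep_pi) IH piZr pi_T_one scalerA [X in X *: _ = _]mulrC.
exact: erefl.
Qed.

Lemma galg_alg_inj : injective (fun d : F => d%:A : A).
Proof.
move=> d e /eqP; rewrite -subr_eq0 -scalerBl scaler_eq0 oner_eq0 orbF subr_eq0.
by move=> /eqP.
Qed.

(** Since [tw] is read off a chosen word, multiplicativity is taken from T_w: by [pi_Tw_one], t(w)
    is the eigenvalue of pi(T_w) on 1. *)
Lemma tw_upr j w : W w -> len (w \o sr j)%VF = (len w).+1 ->
  tw (w \o sr j)%VF = tw w * tj j.
Proof.
move=> wW up; apply: galg_alg_inj; rewrite -pi_Tw_one Tw_upr// (repM rep_pi).
by rewrite pi_T_one piZr pi_Tw_one scalerA [X in X *: _ = _]mulrC.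
Qed.

(* Up to the regular factor [d], the operator of a reduced word of [w] is a
   combination of Weyl group elements with leading term [w]. *)
Lemma pi_word_triangular s : reduced s -> exists d (a : 'End(E) -> A),
  [/\ GRing.lreg d, GRing.lreg (a (sw s)),
      forall u, W u -> a u != 0 -> u = sw s \/ (len u < size s)%N &
      forall f, d * pi (\prod_(j <- s) T j) f = \sum_(u <- We) a u * gact u f].
Proof.
elim: s => [|j s IH] rs.
  exists 1, (fun u => (u == \1%VF)%:R); split=> //; rewrite ?eqxx; do ?exact: lreg1.
    by move=> u _; have [->|_] := eqVneq u; [left|rewrite eqxx].
  move=> f; rewrite big_nil (rep1 rep_pi) mul1r.
  rewrite (bigD1_seq \1%VF) ?uniq_weyl_enum//=; last by apply/mem_weyl_enum.
  rewrite eqxx mul1r gact_id big1 ?addr0// => u /negbTE ->.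
  by rewrite mul0r.
have rs' := reduced_cons rs.
have [d [a [dreg areg asupp aE]]] := IH rs'.
set ld := gact (sr j) d.
(* These are the multiplier and coefficients produced by [clear_denominators]: s_j shifts the index
   in the first term, while the second keeps it. *)
exists ((xa j - 1) * ld * d), (fun u => (tj j *: xa j - (tj j)^-1%:A) * d *
   gact (sr j) (a (sr j \o u)%VF) - c j *: (ld * a u)).
(* This element is too long for the support of [a], so only the shifted term contributes to the new
   leading coefficient, which is then a product of regular factors. *)
have lead : a (sw (j :: s)) = 0.
  apply/eqP; apply: contraT => /(asupp _ (weyl_sw _)); rewrite -rs /= => -[e|]; last lia.
  by move: rs; rewrite /reduced e -rs' /=; lia.
split.
- apply: lregM; last exact: dreg.
  by apply: lregM; [apply: lreg_xa_sub1|apply: gact_lreg].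
- rewrite lead mulr0 scaler0 subr0 sw_cons srKl.
  apply: lregM; last by apply: gact_lreg.
  by apply: lregM => //; apply: lreg_xa_sub; rewrite ?invr_eq0 tj_neq0.
- move=> u uW; have suW := weyl_comp (weyl_sr j) uW.
  have [a1|a1] := eqVneq (a (sr j \o u)%VF) 0; last first.
    move=> _; case: (asupp _ suW a1) => [e|lt]; first by left; rewrite sw_cons -e srKl.
    by right; rewrite /= ltnS; case: (len_srP j uW) lt => ->; lia.
  rewrite a1 linear0 mulr0 sub0r oppr_eq0 => au.
  have {}au : a u != 0 by apply: contraNneq au => ->; rewrite mulr0 scaler0.
  right; case: (asupp _ uW au) => [->|/ltnW//].
  by rewrite /= ltnS rs'.
move=> f; rewrite big_cons (repM rep_pi); set h := pi _ f.
have e1 : (xa j - 1) * pi (T j) h =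
    (tj j *: xa j - (tj j)^-1%:A) * gact (sr j) h - c j *: h.
  by rewrite (rep_T rep_pi); apply: (demazure_lusztig_clear (@mulrC A)) (nablaP j h).
have sE : gact (sr j) (d * h) = \sum_(u <- We) gact (sr j) (a (sr j \o u)%VF) * gact u f.
  rewrite aE linear_sum /= -(sum_weyl_srl j).
  apply: eq_big_seq => u /mem_weyl_enum uW; have suW := weyl_comp (weyl_sr j) uW.
  by rewrite (gactM _ _ (weyl_sr j)) -(gact_comp _ (weyl_sr j) suW) srKl.
rewrite (clear_denominators (@mulrC A) d ld e1) -(gactM _ _ (weyl_sr j)) sE aE.
exact: sum_subZ_mull.
Qed.

(** Descending induction on the length of w. In the relation transported by pi, the coefficient of
    the operator w receives contributions only from w itself and from longer v, for which [e v] is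
    already known to vanish. *)
Lemma Tw_free (e : 'End(E) -> A) :
  \sum_(w <- We) Xf (e w) * Tw w = 0 -> forall w, W w -> e w = 0.
Proof.
move=> rel.
have [N lenN] : exists N, forall w, W w -> (len w < N)%N.
  exists (len w0).+1 => w wW; rewrite ltnS.
  exact: (longestP).2.
suff : forall n w, W w -> (N - n <= len w)%N -> e w = 0.
  by move=> h w wW; apply: (h N) => //; rewrite subnn.
elim=> [|n IH] w wW; first by move=> /leq_trans; rewrite subn0 => lw; have := lenN w wW; rewrite ltnNge lw.
move=> nw.
pose spec v (p : A * ('End(E) -> A)) := W v ->
    [/\ GRing.lreg p.1, GRing.lreg (p.2 v),
      forall u, W u -> p.2 u != 0 -> u = v \/ (len u < len v)%N &
      forall f, p.1 * pi (Tw v) f = \sum_(u <- We) p.2 u * gact u f].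
have [|P expand] := @boolp.choice _ _ spec.
  move=> v; have [vW|nvW] := pselect (W v); last by exists (0, fun=> 0) => /nvW.
  have [d [a]] := pi_word_triangular (redw_word vW).
  by rewrite (sw_redw vW) => da; exists (d, a).
(* The product of all denominators serves as a common one; [m v] is the cofactor left for the term
   of v. *)
pose m v := \prod_(v' <- rem v We) (P v').1.
have mP v : W v -> \prod_(v' <- We) (P v').1 = m v * (P v).1.
  by move=> /mem_weyl_enum vE; rewrite (perm_big _ (perm_to_rem vE)) big_cons mulrC.
have mreg v : GRing.lreg (m v).
  rewrite /m big_seq; apply: (big_ind (@GRing.lreg A)) => [|x y|u /mem_rem/mem_weyl_enum uW].
  - exact: lreg1.
  - exact: lregM.
  - by have [] := expand u uW.
have : \sum_(v <- We) m v * e v * (P v).2 w = 0.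
  pose b u := \sum_(v <- We) m v * e v * (P v).2 u.
  apply: (@gact_independent We b); rewrite ?uniq_weyl_enum//.
  - by move=> u /mem_weyl_enum.
  - move=> f; transitivity (\prod_(v <- We) (P v).1 * pi (\sum_(v <- We) Xf (e v) * Tw v) f).
      rewrite pi_suml mulr_sumr /b.
      under [LHS]eq_bigr => u _ do rewrite mulr_suml.
      rewrite exchange_big /=; apply: eq_big_seq => v /mem_weyl_enum vW.
      rewrite (repM rep_pi) pi_Xf (mP v vW); have [_ _ _ eP] := expand v vW.
      rewrite mulrACA eP mulr_sumr; apply: eq_bigr => u _.
      by rewrite !mulrA.
    by rewrite rel -(scale0r 0) piZl scale0r mulr0.
  - exact/mem_weyl_enum.
have wE : w \in We by apply/mem_weyl_enum.
rewrite (bigD1_seq w) ?uniq_weyl_enum//= big_seq_cond big1 => [|v /andP[/mem_weyl_enum vW vw]].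
  have [_ areg _ _] := expand w wW.
  rewrite addr0 mulrAC => mae; apply: (lregM (mreg w) areg); rewrite mae mulr0//.
have [a0|a0] := eqVneq ((P v).2 w) 0; first by rewrite a0 mulr0.
have [_ _ supp _] := expand v vW; case: (supp _ wW a0) => [ew|lt].
  by rewrite ew eqxx in vw.
by rewrite (IH v vW) ?mulr0 ?mul0r//; move: nw lt; lia.
Qed.

Lemma Tw_inj (e e' : 'End(E) -> A) :
  \sum_(w <- We) Xf (e w) * Tw w = \sum_(w <- We) Xf (e' w) * Tw w ->
  forall w, W w -> e w = e' w.
Proof.
move=> ee' w wW; apply/eqP; rewrite -subr_eq0; apply/eqP.
apply: (Tw_free (e := fun w => e w - e' w)) wW.
by under eq_bigr => u _ do rewrite linearB mulrBl; rewrite sumrB ee' subrr.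
Qed.

Lemma Tw_mul_Xf_expand w f : W w -> exists e : 'End(E) -> A,
  [/\ Tw w * Xf f = \sum_(u <- We) Xf (e u) * Tw u, e w = gact w f &
      forall u, W u -> e u != 0 -> u = w \/ (len u < len w)%N].
Proof.
move=> wW; elim/(weyl_indl): w / wW => [|w j wW up [e [eE ew esupp]]].
  exists (fun u => if u == \1%VF then f else 0); split.
  - rewrite (bigD1_seq \1%VF) ?uniq_weyl_enum//=; last by apply/mem_weyl_enum.
    rewrite eqxx Tw1 mul1r mulr1 big1 ?addr0// => u /negbTE ->.
    by rewrite linear0 mul0r.
  - by rewrite eqxx gact_id.
  - by move=> u _; have [->|_] := eqVneq u; [left|rewrite eqxx].
have sE u : W u -> T j * (Xf (e u) * Tw u) =
    Xf (gact (sr j) (e u)) * Tw (sr j \o u)%VF +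
    Xf ((if left_descent j u then c j else 0) *: gact (sr j) (e u) + c j *: nabla j (e u)) * Tw u.
  move=> uW; rewrite mulrA T_mul_Xf mulrDl -mulrA T_mul_Tw// mulrDr -addrA.
  rewrite -scalerAr; move: (gact _ (e u)) (nabla j (e u)) => y n.
  rewrite XfP; move: (Xf y) (Xf n) => y' n'.
  by rewrite mulrDl -2!scalerAl.
exists (fun u => gact (sr j) (e (sr j \o u)%VF) +
  ((if left_descent j u then c j else 0) *: gact (sr j) (e u) + c j *: nabla j (e u))); split.
- rewrite Tw_up// -mulrA eE mulr_sumr.
  under [RHS]eq_bigr => u _ do rewrite linearD mulrDl.
  rewrite [RHS]big_split /= -[X in X + _](sum_weyl_srl j) -big_split /=.
  by apply: eq_big_seq => u /mem_weyl_enum uW; rewrite sE// srKl.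
(* The terms not shifted by s_j vanish at s_j w, which is longer than w, so the leading coefficient
   is the shifted one alone. *)
- have -> : e (sr j \o w)%VF = 0.
    apply/eqP; apply: contraT => /(esupp _ (weyl_comp (weyl_sr j) wW)); rewrite up => -[e'|]; last lia.
    by move: up; rewrite e'; lia.
  by rewrite !linear0 !addr0 srKl ew gact_comp.
- move=> u uW; have suW := weyl_comp (weyl_sr j) uW.
  have [e1|e1] := eqVneq (e (sr j \o u)%VF) 0; last first.
    move=> _; case: (esupp _ suW e1) => [<-|lt]; first by left; rewrite srKl.
    by right; rewrite up; case: (len_srP j uW) lt => ->; lia.
  rewrite e1 linear0 add0r => eu.
  have {}eu : e u != 0 by apply: contraNneq eu => ->; rewrite !linear0 addr0.
  by right; rewrite up; case: (esupp _ uW eu) => [->|/ltnW].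
Qed.

(** * Expansion of the symmetrizers *)

Section Intertwiner.
Variables (G : H) (k : 'End(E) -> F) (q q' : 'I_r -> A -> A).
Hypothesis GE : G = \sum_(w <- We) k w *: Tw w.
Hypothesis G_mul_T : forall j f, G * Xf f * T j = G * Xf (q j f).
Hypothesis qK : forall j f, q j (q' j f) = f.

(** The first letter acts first, so with q_j = pi(T_j) the operators compose in reversed order; this
    is how v^-1 enters the formula for 1^+. *)
Lemma intertwiner_mul_Tw w f : G * Xf f * Tw w = G * Xf (foldl (fun g j => q j g) f (redw w)).
Proof.
rewrite /Defs.Tw; elim: (redw w) f => [|j s IH] f; first by rewrite big_nil mulr1.
by rewrite big_cons mulrA G_mul_T IH.
Qed.

(** Only the summand of w0 in G reaches T_{w0}: the lower terms of every T_w f are shorter than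
    w. *)
Lemma intertwiner_top f : exists e : 'End(E) -> A,
  G * Xf f = \sum_(u <- We) Xf (e u) * Tw u /\ e w0 = k w0 *: gact w0 f.
Proof.
pose spec w (e : 'End(E) -> A) := W w ->
  [/\ Tw w * Xf f = \sum_(u <- We) Xf (e u) * Tw u, e w = gact w f &
      forall u, W u -> e u != 0 -> u = w \/ (len u < len w)%N].
have [w|e eP] := @boolp.choice _ _ spec.
  have [wW|nW] := pselect (W w); last by exists (fun=> 0) => /nW.
  by have [e eP] := Tw_mul_Xf_expand f wW; exists e.
exists (fun u => \sum_(w <- We) k w *: e w u); split.
  rewrite GE mulr_suml; under [RHS]eq_bigr => u _ do rewrite linear_sum mulr_suml.
  rewrite exchange_big /=; apply: eq_big_seq => w /mem_weyl_enum wW.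
  have [e1 _ _] := eP w wW; rewrite -scalerAl e1 scaler_sumr.
  by apply: eq_bigr => u _; rewrite linearZ -scalerAl.
have w0E : w0 \in We by apply/mem_weyl_enum.
rewrite (bigD1_seq w0) ?uniq_weyl_enum//= big_seq_cond big1 ?addr0.
  by have [_ -> _] := eP w0 weyl_w0.
move=> w /andP[/mem_weyl_enum wW ww0]; have [_ _ supp] := eP w wW.
have [->|nz] := eqVneq (e w w0) 0; first by rewrite scaler0.
case: (supp _ weyl_w0 nz) => [ew|]; first by rewrite ew eqxx in ww0.
by rewrite ltnNge (longestP).2.
Qed.

(** A reduced word of (w0 w)^-1 = w^-1 w0 leads from w up to w0 by right multiplication, and each of
    its letters costs one [q']. *)
Lemma intertwiner_expand f : G * Xf f = \sum_(w <- We)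
  k w0 *: (Xf (gact w0 (foldl (fun g j => q' j g) f (redw (w0 \o w)^-1%VF))) * Tw w).
Proof.
have [a aP] := @boolp.choice _ _ (fun f (e : 'End(E) -> A) =>
  G * Xf f = \sum_(u <- We) Xf (e u) * Tw u /\ e w0 = k w0 *: gact w0 f) intertwiner_top.
have step j w g : W w -> len (w \o sr j)%VF = (len w).+1 -> a (q j g) w = a g (w \o sr j)%VF.
  (* [b] lists the coefficients of G g T_j; its second term is present only at right descents, so it
     disappears at w. *)
  move=> wW up; pose b u := a g (u \o sr j)%VF + (if right_descent j u then c j else 0) *: a g u.
  have -> : a (q j g) w = b w.
    apply: (Tw_inj (e := a (q j g)) (e' := b)) wW; rewrite -(aP _).1 -G_mul_T (aP g).1.
    rewrite mulr_suml; under [RHS]eq_bigr => u _ do rewrite linearD mulrDl.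
    rewrite [RHS]big_split /= -[X in X + _](sum_weyl_srr j) -big_split /=.
    apply: eq_big_seq => u /mem_weyl_enum uW.
    by rewrite srKr -mulrA Tw_mul_T// mulrDr linearZ -scalerAl scalerAr.
  by rewrite /b /right_descent up ltnNge leqnSn scale0r addr0.
have main s w g : W w -> sw s = (w^-1 \o w0)%VF -> size s = len (w^-1 \o w0)%VF ->
    a g w = k w0 *: gact w0 (foldl (fun g j => q' j g) g s).
  elim: s w g => [|j s IH] w g wW es ss.
    rewrite /= -(aP g).2; congr (a g _).
    by rewrite -[w]comp_lfun1r -[\1%VF]/(sw [::]) es comp_lfunA weylKV ?comp_lfun1l.
  have uW := weyl_comp wW (weyl_sr j).
  have eV : (w \o sr j)^-1%VF = (sr j \o w^-1)%VF.
    by rewrite weyl_inv_comp ?sr_inv//; apply: weyl_sr.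
  have es' : sw s = ((w \o sr j)^-1 \o w0)%VF.
    by rewrite eV -comp_lfunA -es sw_cons srKl.
  have rs : reduced (j :: s) by rewrite /reduced es.
  have rs' := reduced_cons rs.
  have lw := len_invr_w0 wW.
  have lu := len_invr_w0 uW.
  (* The word left for w s_j is one letter shorter, so by [len_invr_w0] w s_j is one longer than w,
     as [step] demands. *)
  rewrite -{1}[g](qK j) step//; last first.
    by move: lw lu; rewrite -ss -es' -rs' /=; lia.
  by rewrite IH// -es'.
rewrite (aP f).1; apply: eq_big_seq => w /mem_weyl_enum wW.
have wE : (w0 \o w)^-1%VF = (w^-1 \o w0)%VF.
  by rewrite weyl_inv_comp// (w0_inv).
have vW : W (w^-1 \o w0)%VF by apply: weyl_comp => //; apply: weyl_inv.
rewrite (main (redw (w0 \o w)^-1%VF))//; last 2 first.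
- by rewrite wE sw_redw.
- by rewrite wE.
by rewrite linearZ -scalerAl.
Qed.

End Intertwiner.

(** Multiplication by T_j mixes only T_w and T_{w s_j}. On each such pair the claim reduces to the
    quadratic relation for [e j], whose roots are t_j and -t_j^-1. *)
Lemma character_mul_T (chi : 'End(E) -> F) (e : 'I_r -> F) j :
  (forall i w, W w -> len (w \o sr i)%VF = (len w).+1 ->
     chi (w \o sr i)%VF = chi w * e i) ->
  e j ^+ 2 = c j * e j + 1 ->
  (\sum_(w <- We) chi w *: Tw w) * T j = e j *: \sum_(w <- We) chi w *: Tw w.
Proof.
move=> chiM e2; rewrite mulr_suml scaler_sumr.
transitivity (\sum_(w <- We) (chi (w \o sr j)%VF + chi w * (if right_descent j w then c j else 0)) *: Tw w).
  under [RHS]eq_bigr => w _ do rewrite scalerDl.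
  rewrite [RHS]big_split /= -[X in X + _](sum_weyl_srr j) -big_split /=.
  apply: eq_big_seq => w /mem_weyl_enum wW.
  by rewrite srKr -scalerAl Tw_mul_T// scalerDr scalerA.
apply: eq_big_seq => w /mem_weyl_enum wW; rewrite scalerA; congr (_ *: _).
rewrite /right_descent; have [up|dn] := len_srrP j wW.
  by rewrite up ltnNge leqnSn /= mulr0 addr0 chiM// mulrC.
have uW := weyl_comp wW (weyl_sr j); have := chiM j _ uW; rewrite srKr => /(_ dn) ->.
rewrite dn ltnSn; move: (chi _) => x.
by rewrite (mulrCA (e j)) -expr2 e2; ring.
Qed.

Lemma eigen_mul_Xf_mul_T (G : H) (e : 'I_r -> F) : (forall j, G * T j = e j *: G) ->
  forall j f, G * Xf f * T j = G * Xf (e j *: gact (sr j) f + c j *: nabla j f).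
Proof.
move=> eG j f; rewrite -mulrA Xf_mul_T; move: (gact _ f) (nabla j f) => y n.
rewrite XfP; move: (Xf y) (Xf n) => y' n'.
by rewrite 2!mulrDr mulrA eG -scalerAl -!scalerAr.
Qed.

Lemma unit_prod_T s : \prod_(j <- s) T j \is a GRing.unit.
Proof. by apply: rpred_prod => j _; apply: unit_T. Qed.

Lemma foldl_pi f s :
  foldl (fun g j => pi (T j) g) f s = pi (\prod_(j <- rev s) T j) f.
Proof.
elim: s f => [|j s IH] f; first by rewrite big_nil (rep1 rep_pi).
by rewrite /= IH rev_cons big_rcons (repM rep_pi).
Qed.

Lemma foldl_piV f s :
  foldl (fun g j => pi (T j)^-1 g) f s = pi (\prod_(j <- s) T j)^-1 f.
Proof.
elim: s f => [|j s IH] f; first by rewrite big_nil invr1 (rep1 rep_pi).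
by rewrite /= IH big_cons invrM ?unit_T ?unit_prod_T// (repM rep_pi).
Qed.

(** The inner iotas cancel in pairs, and each letter leaves a sign. *)
Lemma foldl_giota (p : 'I_r -> {linear A -> A}) f s :
  foldl (fun g j => - giota (p j (giota g))) f s =
  (-1) ^+ size s *: giota (foldl (fun g j => p j g) (giota f) s).
Proof.
elim: s f => [|j s IH] f; first by rewrite expr0 scale1r giotaK.
have foldlN g : foldl (fun g j => p j g) (- g) s = - foldl (fun g j => p j g) g s.
  by elim: (s) g => //= i s' IHs g; rewrite linearN IHs.
rewrite /= IH [giota (- _)]linearN /= giotaK foldlN linearN /= scalerN.
by rewrite exprS mulN1r scaleNr.
Qed.

Lemma Tw_rev_redw w : W w -> \prod_(j <- rev (redw w)) T j = Tw w^-1%VF.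
Proof.
move=> wW; have e : sw (rev (redw w)) = w^-1%VF.
  by rewrite -(sw_inv) sw_redw.
rewrite -Tw_word ?e// /reduced size_rev e (len_inv wW).
by [].
Qed.

(** * The two product formulas *)

Variable gamma : 'End(E) -> H -> A.
Hypothesis gammaP : hecke_coordinates dot Phi alpha T X gamma.

Lemma hecke_coordinates_enum h : h = \sum_(v <- We) Xf (gamma v h) * Tw v.
Proof. by rewrite {1}(gammaP h) (sum_weyl). Qed.

Lemma one_plus_mul h : one_plus dot Phi alpha t T * h =
  \sum_(w \in W) tw w0 *: (Xf (gact w0 (\sum_(v \in W)
    pi ((Tw (w0 \o w)^-1%VF)^-1 * Tw v^-1%VF) (gamma v h))) * Tw w).
Proof.
pose G := \sum_(w <- We) tw w *: Tw w.
have -> : one_plus dot Phi alpha t T = G by exact: sum_weyl _ _.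
have GT j f : G * Xf f * T j = G * Xf (pi (T j) f).
  rewrite (rep_T rep_pi) (eigen_mul_Xf_mul_T (e := tj))// => i.
  apply: character_mul_T => [j' w wW up|]; first exact: tw_upr.
  by rewrite mulrBl mulVf ?tj_neq0// subrK.
have qK j f : pi (T j) (pi (T j)^-1 f) = f by rewrite pi_mulVK ?unit_T.
rewrite (sum_weyl).
have -> : G * h = G * Xf (\sum_(v <- We) pi (Tw v^-1%VF) (gamma v h)).
  rewrite {1}(hecke_coordinates_enum h) linear_sum !mulr_sumr; apply: eq_big_seq => v /mem_weyl_enum vW.
  by rewrite mulrA (intertwiner_mul_Tw GT) foldl_pi Tw_rev_redw.
rewrite (intertwiner_expand (G := G) (k := tw) erefl GT qK).
apply: eq_bigr => w _; congr (_ *: (Xf (gact w0 _) * _)).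
rewrite foldl_piV (sum_weyl) linear_sum.
by apply: eq_bigr => v _; rewrite (repM rep_pi).
Qed.

Lemma pi_TV j f :
  pi (T j)^-1 f = tj j *: gact (sr j) f + c j *: nabla j f - c j *: f.
Proof.
have piN h g : pi (- h) g = - pi h g by rewrite -scaleN1r piZl scaleN1r.
by rewrite T_inv piDl piN (rep_T rep_pi) piZl (rep1 rep_pi).
Qed.

Lemma pi_mulKV h f : h \is a GRing.unit -> pi h^-1 (pi h f) = f.
Proof. by move=> hu; rewrite -(repM rep_pi) mulVr// (rep1 rep_pi). Qed.

Lemma one_minus_mul h : one_minus dot Phi alpha t T * h =
  \sum_(w \in W) ((tw w0)^-1 * (-1) ^+ len w) *:
    (Xf (gact w0 (giota (\sum_(v \in W) (-1) ^+ len v *: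
      pi (Tw (w0 \o w)%VF * (Tw v)^-1) (giota (gamma v h))))) * Tw w).
Proof.
pose chi w : F := (-1) ^+ len w * (tw w)^-1.
pose G := \sum_(w <- We) chi w *: Tw w.
pose q j f : A := - giota (pi (T j)^-1 (giota f)).
pose q' j f : A := - giota (pi (T j) (giota f)).
have -> : one_minus dot Phi alpha t T = G by exact: sum_weyl _ _.
have GT j f : G * Xf f * T j = G * Xf (q j f).
  rewrite (eigen_mul_Xf_mul_T (e := fun j => - (tj j)^-1)) => [|i].
    (* Expand the inverse by [pi_TV] and conjugate by iota, which commutes with s_j and changes
       nabla_j as in [giota_nabla]. *)
    have -> : q j f = - (tj j *: gact (sr j) f +
        c j *: (f - gact (sr j) f - nabla j f) - c j *: f).
      have -> : gact (sr j) f = giota (gact (sr j) (giota f)).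
        by rewrite (gact_giota _ (weyl_sr j)) giotaK.
      have -> : f - giota (gact (sr j) (giota f)) - nabla j f = giota (nabla j (giota f)).
        by rewrite giota_nabla (gact_giota _ (weyl_sr j)) giotaK.
      rewrite /q pi_TV giotaB (giotaZ _ (giota f)) giotaK.
      move: (gact (sr j) (giota f)) (nabla j (giota f)) => y n.
      by rewrite giotaP.
    congr (_ * Xf _); apply/esym.
    exact: (@opp_scale_sub F A (tj j) (tj j)^-1 f (gact (sr j) f) (nabla j f)).
  apply: (character_mul_T (e := fun j => - (tj j)^-1)) => [j' w wW up|].
    rewrite /chi up (tw_upr wW up); move: (len w) (tw w) (tj j') => n x y.
    by rewrite exprS invfM; ring.
  by field; apply: tj_neq0.
have qK j f : q j (q' j f) = f.
  by rewrite /q /q' giotaN giotaK piNr (pi_mulKV _ (unit_T j)) giotaN opprK giotaK.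
rewrite (sum_weyl).
have -> : G * h = G * Xf (\sum_(v <- We) (-1) ^+ len v *: giota (pi (Tw v)^-1 (giota (gamma v h)))).
  rewrite {1}(hecke_coordinates_enum h) linear_sum !mulr_sumr; apply: eq_big_seq => v /mem_weyl_enum vW.
  rewrite mulrA (intertwiner_mul_Tw GT).
  by rewrite (foldl_giota (fun j => pi (T j)^-1)) foldl_piV.
rewrite (intertwiner_expand (G := G) (k := chi) erefl GT qK).
apply: eq_big_seq => w /mem_weyl_enum wW; have w0wW := weyl_comp weyl_w0 wW.
rewrite (foldl_giota (fun j => pi (T j))) foldl_pi Tw_rev_redw ?weyl_invK//; last exact: weyl_inv.
rewrite !linearZ /= -scalerAl scalerA; congr (_ *: (Xf (gact w0 (giota _)) * _)).
  (* The signs of w0, from [chi], and of w0 w, from [foldl_giota], combine to that of w, because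
     l(w0) = l(w) + l(w^-1 w0). *)
  rewrite /chi mulrAC -exprD mulrC; congr (_ * _).
  have lw := len_invr_w0 wW.
  rewrite -[size _]/(len (w0 \o w)^-1%VF) weyl_inv_comp// (w0_inv).
  by rewrite -lw -addnA exprD addnn -mul2n exprM sqrrN expr1n expr1n mulr1.
rewrite (sum_weyl) linear_sum linear_sum; apply: eq_bigr => v _.
by rewrite /= giotaZ giotaK piZr (repM rep_pi).
Qed.

End Weyl.

Theorem corollary4p8 (R : realType) (E : vectType R) (dot : {dot E for idfun})
  (Phi : seq 'Hom(E, R^o)) (r : nat) (alpha : r.-tuple 'Hom(E, R^o))
  (F : fieldType) (t : 'Hom(E, R^o) -> F) (L : zmodClosed E)
  (H : unitAlgType F) (T : 'I_r -> H) (X : latt L -> H)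
  (pi : H -> galg F (latt L) -> galg F (latt L))
  (gamma : 'End(E) -> H -> galg F (latt L))
  (w0 := longest dot alpha Phi) (W := weyl dot Phi)
  (TW := Tw dot alpha T) (tW := tw dot alpha t) (l := len dot alpha) :
  root_system dot Phi ->
  simple_roots Phi alpha ->
  weyl_invariant dot Phi t ->
  root_lattice dot Phi L ->
  affine_hecke dot alpha t T X ->
  polynomial_rep dot alpha t T X pi ->
  hecke_coordinates dot Phi alpha T X gamma ->
  forall h : H,
    one_plus dot Phi alpha t T * h =
      \sum_(w \in W)
        tW w0 *:
        (glin X (gact w0 (\sum_(v \in W)
           pi ((TW (w0 \o w)^-1%VF)^-1 * TW v^-1%VF) (gamma v h))) * TW w)
    /\
    one_minus dot Phi alpha t T * h =
      \sum_(w \in W)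
        ((tW w0)^-1 * (-1) ^+ l w) *:
        (glin X (gact w0 (giota (\sum_(v \in W)
           (-1) ^+ l v *:
           pi (TW (w0 \o w)%VF * (TW v)^-1) (giota (gamma v h))))) * TW w).
Proof.
move=> rootPhi simple_alpha inv_t lattL [heckeH _ _] rep_pi gammaP h.
split; first exact: (one_plus_mul rootPhi simple_alpha lattL inv_t heckeH rep_pi gammaP).
exact: (one_minus_mul rootPhi simple_alpha lattL inv_t heckeH rep_pi gammaP).
Qed.
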